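(* Let $(R,\mathfrak m)$ be a $1$-dimensional Cohen-Macaulay local ring with a canonical ideal. If $R$ is not Gorenstein, then $\mathrm{root}(R)$ is a finite set of cardinality less than $r(R)$.
   Context: All rings are commutative Noetherian. A canonical ideal $C$ of a Cohen-Macaulay local ring $R$ is an ideal of $R$ isomorphic, as an $R$-module, to the canonical module of $R$. $r(R)$ is the Cohen-Macaulay type, i.e. the minimal number of generators of $C$. An ideal $L$ of $R$ is a root of $C$ if $L^n\simeq C$ (as $R$-modules) for some positive integer $n$; then $\tau_L(C)=\min\{n\ge 1: L^n\simeq C\}$. The rootset of $R$ is $\mathrm{root}(R)=\{\tau_L(C) : L \text{ is a root of } C\}$; it does not depend on the choice of $C$. *)

(* Defs.v *)
From HB Require Import structures.
From mathcomp Require Import all_boot all_order all_algebra.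
From mathcomp Require Import finmap.
From mathcomp Require Import mathcomp_extra boolp classical_sets functions.
From mathcomp Require Import cardinality.

Set Implicit Arguments.
Unset Strict Implicit.
Unset Printing Implicit Defensive.

Import GRing.Theory.
Local Open Scope ring_scope.

(* Ideals, the unit ideal included, are the submodules of R^o; MathComp's
   [idealr R] and [prime_idealr R] contain proper ideals only. *)
Notation ideal R := (submodClosed R^o).

Section Submodules.
Variables (R : nzRingType) (V : lmodType R) (S : submodClosed V).

Inductive submodule : predArgType := Submodule (v : V) of v \in S.
Definition submodule_val (u : submodule) : V := let: Submodule v _ := u in v.

HB.instance Definition _ := [isSub for submodule_val].
HB.instance Definition _ := [Choice of submodule by <:].
HB.instance Definition _ := [SubChoice_isSubLmodule of submodule by <:].

End Submodules.
Arguments submodule {R V} S.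

Definition mod_iso (R : nzRingType) (U V : lmodType R) :=
  exists f : {linear U -> V}, bijective f.

Section Generators.
Variables (R : nzRingType) (M : lmodType R).

Definition generated_by (n : nat) :=
  exists v : 'I_n -> M, forall x, exists a : 'I_n -> R,
    x = \sum_(i < n) a i *: v i.

Definition finitely_generated := exists n, generated_by n.

(* 0 when M is not finitely generated. *)
Definition min_gens : nat :=
  xget 0%N [set n | generated_by n /\
                    forall k, generated_by k -> (n <= k)%N]%classic.

End Generators.

Definition noetherian (R : comNzRingType) :=
  forall I : ideal R, finitely_generated (submodule I).

Section IdealPowers.
Variable R : comNzRingType.

Definition unit_ideal_pred : {pred R^o} := fun=> true.

Lemma unit_ideal_closed : subsemimod_closed unit_ideal_pred.
Proof. by []. Qed.

HB.instance Definition _ :=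
  GRing.isSubmodClosed.Build R R^o unit_ideal_pred unit_ideal_closed.

Definition idealM_pred (I J : ideal R) : {pred R^o} := fun x =>
  `[< exists n (a b : 'I_n -> R),
        [/\ forall i, a i \in I, forall i, b i \in J
          & x = \sum_(i < n) a i * b i] >].

Lemma idealM_closed I J : subsemimod_closed (idealM_pred I J).
Proof.
split; first split.
- by apply/asboolP; exists 0%N, (fun=> 0), (fun=> 0); split=> [[]|[]|] //;
    rewrite big_ord0.
- move=> x y /asboolP[n [a [b [aI bJ ->]]]] /asboolP[p [c [d [cI dJ ->]]]].
  apply/asboolP; exists (n + p)%N,
    (fun i : 'I_(n + p) => match fintype.split i with inl j => a j | inr j => c j end),
    (fun i : 'I_(n + p) => match fintype.split i with inl j => b j | inr j => d j end).
  split=> [i|i|]; do ?by case: fintype.splitP.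
  rewrite big_split_ord; congr (_ + _); apply: eq_bigr => i _ /=.
    by case: fintype.splitP => [j /= /ord_inj-> //|j /= ij];
      have := ltn_ord i; rewrite ij -ltn_subRL subnn.
  case: fintype.splitP => [j /= ij|j /= /eqP]; last by rewrite eqn_add2l => /eqP/ord_inj->.
  by have := ltn_ord j; rewrite -ij -ltn_subRL subnn.
- move=> r x /asboolP[n [a [b [aI bJ ->]]]]; apply/asboolP.
  exists n, (fun i => r * a i), b; split=> // [i|].
    exact: (rpredZ r (aI i)).
  by rewrite scaler_sumr; apply: eq_bigr => i _; rewrite -mulrA.
Qed.

HB.instance Definition _ (I J : ideal R) :=
  GRing.isSubmodClosed.Build R R^o (idealM_pred I J) (@idealM_closed I J).

Definition idealM (I J : ideal R) : ideal R := idealM_pred I J.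

Definition idealX (L : ideal R) (n : nat) : ideal R :=
  iter n (idealM L) unit_ideal_pred.

End IdealPowers.

Section LocalRings.
Variable R : comNzRingType.

Definition maximal_ideal (m : idealr R) :=
  forall I : idealr R, {subset m <= I} -> I =i m.

Definition local_ring (m : idealr R) :=
  maximal_ideal m /\ forall m' : idealr R, maximal_ideal m' -> m' =i m.

End LocalRings.

Section Dimension.
Variables (R : comNzRingType) (M : lmodType R).

(* A chain p_0 < ... < p_n of primes containing Ann(M); for M = R^o the
   annihilator is 0, which gives the Krull dimension of R. *)
Definition prime_chain (n : nat) :=
  exists p : nat -> prime_idealr R,
    (forall a : R, (forall x : M, a *: x = 0) -> a \in p 0%N) /\
    (forall i, (i < n)%N ->
       {subset p i <= p i.+1} /\ ~ {subset p i.+1 <= p i}).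

Definition krull_dim (d : nat) :=
  prime_chain d /\ forall n, prime_chain n -> (n <= d)%N.

End Dimension.

Section Depth.
Variables (R : comNzRingType) (m : idealr R) (M : lmodType R).

(* x belongs to the submodule (s_0, ..., s_(k-1)) M. *)
Definition in_smul (s : seq R) (x : M) :=
  exists w : nat -> M, x = \sum_(i < size s) s`_i *: w i.

Definition regular_seq (s : seq R) :=
  (forall i, (i < size s)%N -> forall x : M,
     in_smul (take i s) (s`_i *: x) -> in_smul (take i s) x) /\
  exists x : M, ~ in_smul s x.

Definition depth (t : nat) :=
  (exists s, [/\ all (mem m) s, regular_seq s & size s = t]) /\
  forall s, all (mem m) s -> regular_seq s -> (size s <= t)%N.

End Depth.

Definition cohen_macaulay (R : comNzRingType) (m : idealr R) :=
  exists d, depth m R^o d /\ krull_dim R^o d.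

Definition maximal_cohen_macaulay (R : comNzRingType) (m : idealr R)
    (M : lmodType R) :=
  finitely_generated M /\
  exists d, [/\ depth m M d, krull_dim M d & krull_dim R^o d].

Section Injective.
Variable R : comNzRingType.

Definition injective_module (E : lmodType R) :=
  forall (A B : lmodType R) (i : {linear A -> B}) (f : {linear A -> E}),
    injective i -> exists g : {linear B -> E}, forall a, g (i a) = f a.

Record injective_resolution (M : lmodType R) := InjectiveResolution {
  res_obj : nat -> lmodType R;
  res_d : forall i, {linear res_obj i -> res_obj i.+1};
  res_aug : {linear M -> res_obj 0%N};
  res_injective : forall i, injective_module (res_obj i);
  res_aug_inj : injective res_aug;
  res_exact0 : forall y, res_d 0%N y = 0 <-> exists x, res_aug x = y;
  res_exactS : forall i y,
    res_d i.+1 y = 0 <-> exists x, res_d i x = y }.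

Definition finite_injdim (M : lmodType R) :=
  exists (I : injective_resolution M) (n : nat),
    forall i, (n < i)%N -> forall x : res_obj I i, x = 0.

Section Ext.
Variables (K M : lmodType R) (I : injective_resolution M).

Definition ext_cocycle i (f : {linear K -> res_obj I i}) :=
  forall x, res_d I i (f x) = 0.

Definition ext_coboundary i : {linear K -> res_obj I i} -> Prop :=
  match i with
  | 0 => fun f => forall x, f x = 0
  | j.+1 => fun f =>
      exists g : {linear K -> res_obj I j}, forall x, f x = res_d I j (g x)
  end.

End Ext.

(* pi exhibits K as the quotient module R / m. *)
Definition residue_module (m : idealr R) (K : lmodType R)
    (pi : {linear R^o -> K}) :=
  (forall y, exists x, pi x = y) /\ forall x, pi x = 0 <-> x \in m.

(* dim_(R/m) Ext^i(R/m, M) = n: the cocycles e_0, ..., e_(n-1) give a basis of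
   H^i(Hom(R/m, I)) over R/m. A combination of the e_j is taken with
   coefficients in R; the scalar action of m on Ext^i(R/m, M) is zero. *)
Definition bass_number (m : idealr R) (M : lmodType R) (i n : nat) :=
  exists (K : lmodType R) (pi : {linear R^o -> K})
         (I : injective_resolution M) (e : 'I_n -> {linear K -> res_obj I i}),
  [/\ residue_module m pi,
      forall j, ext_cocycle (e j),
      forall f : {linear K -> res_obj I i}, ext_cocycle f ->
        exists (a : 'I_n -> R) (h : {linear K -> res_obj I i}),
          ext_coboundary h /\
          forall x, f x = \sum_(j < n) a j *: e j x + h x
    & forall (a : 'I_n -> R) (h : {linear K -> res_obj I i}),
        ext_coboundary h ->
        (forall x, h x = \sum_(j < n) a j *: e j x) -> forall j, a j \in m].

Definition cm_type (m : idealr R) (M : lmodType R) (r : nat) :=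
  exists t, depth m M t /\ bass_number m M t r.

End Injective.

(* For Noetherian local rings. *)
Definition gorenstein (R : comNzRingType) := finite_injdim R^o.

(* For Cohen-Macaulay local rings, following Bruns and Herzog. *)
Definition canonical_module (R : comNzRingType) (m : idealr R)
    (W : lmodType R) :=
  [/\ maximal_cohen_macaulay m W, cm_type m W 1 & finite_injdim W].

Definition canonical_ideal (R : comNzRingType) (m : idealr R) (C : ideal R) :=
  exists W : lmodType R, canonical_module m W /\ mod_iso (submodule C) W.

Section Rootset.
Variables (R : comNzRingType) (C : ideal R).

Definition power_iso (L : ideal R) (n : nat) :=
  (0 < n)%N /\ mod_iso (submodule (idealX L n)) (submodule C).

Definition is_root (L : ideal R) := exists n, power_iso L n.

(* tau_L(C) = n *)
Definition is_tau (L : ideal R) (n : nat) :=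
  power_iso L n /\ forall k, power_iso L k -> (n <= k)%N.

Definition rootset : set nat :=
  [set n | exists L : ideal R, is_root L /\ is_tau L n]%classic.

End Rootset.

(* Main.v *)
From HB Require Import structures.
Require Import Defs.
From mathcomp Require Import all_boot all_order all_algebra.
From mathcomp Require Import finmap ring zify.
From mathcomp Require Import boolp classical_sets cardinality.

(* Let L be an ideal with L^n isomorphic to C and n = tau_L(C); it suffices to
   show that C needs more than n generators. Otherwise, by the case r = 1 of
   the Eakin-Sathaye theorem, a generic linear form y in the generators of L
   satisfies y L^(n-1) = L^n. As the residue field may be finite, y lives in
   R[X], and the equality holds up to a polynomial u having a unit coefficient.
   Since L^n : L^n = C : C = R, this forces L^n : L^(n-1) to be principal,
   hence L^n and L^(n-1) are isomorphic: this contradicts the minimality of n,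
   or, when n = 1, the hypothesis that R is not Gorenstein.

   That C is faithful and C : C = R is read modulo a regular element x of m.
   Finite injective dimension gives Ext^2(R/J, C) = 0 for all J containing x,
   by descending induction on the degree, so that C/xC is an injective module
   over R/xR; its socle is simple because C has type 1. *)

Set Implicit Arguments.
Unset Strict Implicit.
Unset Printing Implicit Defensive.

Import GRing.Theory.
Local Open Scope classical_set_scope.
Local Open Scope ring_scope.

(** Vanishing of Ext^2 amounts to injectivity of C/xC because Ext^1(R/J, C) = Hom(R/J, C/xC) for J
    containing x: extending a map from a submodule of R/J is obstructed by Ext^2 of the quotient.
    The modules R/J and C/xC are not formed: a map from R/J is the image of 1, an element killed by
    J, and C/xC is C up to multiples of x. Likewise colons are taken without a ring of fractions, by
    clearing a regular element of L^n.

    Eakin-Sathaye is proved by duality. If every linear form in the generators of L failed, each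
    would annihilate a nonzero functional on L^n, and a suitable succession of forms would produce n
    + 1 independent functionals, one more than n generators allow. An infinite field is needed to
    choose a form avoiding finitely many conditions at once. *)

Section SetIdeals.
Variable R : comNzRingType.
Implicit Types (I J P : set R) (a b r : R).

(** Plain sets make sums and colons of ideals immediate to define; bundled ideals are built only
    where the definitions of the statement require them. *)
Definition is_ideal I :=
  [/\ I 0, forall a b, I a -> I b -> I (a + b) & forall r a, I a -> I (r * a)].

Definition is_prime P :=
  [/\ is_ideal P, ~ P 1 & forall a b, P (a * b) -> P a \/ P b].

Definition adjoin I a : set R := [set b | exists i r, I i /\ b = i + r * a].

(** The colon ideal (I : a), that is, the annihilator of the class of [a] in R/I. *)
Definition quo I a : set R := [set r | I (r * a)].

Lemma ideal0 I : is_ideal I -> I 0. Proof. by case. Qed.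
Lemma idealD I a b : is_ideal I -> I a -> I b -> I (a + b).
Proof. by case=> _ D _; apply: D. Qed.
Lemma idealMl I r a : is_ideal I -> I a -> I (r * a).
Proof. by case=> _ _ Z; apply: Z. Qed.
Lemma idealN I a : is_ideal I -> I a -> I (- a).
Proof. by rewrite -mulN1r; apply: idealMl. Qed.
Lemma idealB I a b : is_ideal I -> I a -> I b -> I (a - b).
Proof. by move=> idI Ia Ib; exact: idealD idI Ia (idealN idI Ib). Qed.
Lemma ideal_sum I (T : finType) (F : T -> R) :
  is_ideal I -> (forall i, I (F i)) -> I (\sum_i F i).
Proof.
by move=> idI IF; apply: big_ind => // [|a b]; [apply: ideal0|apply: idealD].
Qed.

Lemma set0_ideal : is_ideal [set 0].
Proof.
by split=> // [a b /= -> ->|r a /= ->]; rewrite ?addr0 ?mulr0.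
Qed.

Lemma principal_ideal x : is_ideal [set x * r | r in [set: R]].
Proof.
split; first by exists 0; rewrite ?mulr0.
- by move=> _ _ [r _ <-] [s _ <-]; exists (r + s); rewrite ?mulrDr.
- by move=> s _ [r _ <-]; exists (s * r); rewrite // mulrCA.
Qed.

Lemma adjoin_ideal I a : is_ideal I -> is_ideal (adjoin I a).
Proof.
move=> idI; split; first by exists 0, 0; rewrite mul0r addr0; split=> //; apply: ideal0.
- move=> _ _ [i [r [Ii ->]]] [j [s [Ij ->]]]; exists (i + j), (r + s).
  by split; [apply: idealD|ring].
- move=> s _ [i [r [Ii ->]]]; exists (s * i), (s * r).
  by split; [apply: idealMl|ring].
Qed.

Lemma sub_adjoin I a : I `<=` adjoin I a.
Proof. by move=> i Ii; exists i, 0; rewrite mul0r addr0. Qed.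

Lemma mem_adjoin I a : is_ideal I -> adjoin I a a.
Proof. by exists 0, 1; rewrite mul1r add0r; split=> //; apply: ideal0. Qed.

Lemma quo_ideal I a : is_ideal I -> is_ideal (quo I a).
Proof.
move=> idI; split; rewrite /quo /=; first by rewrite mul0r; apply: ideal0.
- by move=> b c; rewrite mulrDl; apply: idealD.
- by move=> r b; rewrite -mulrA; apply: idealMl.
Qed.

Lemma mem_ideal (I : ideal R) : is_ideal [set a | a \in I].
Proof.
split; first exact: rpred0.
- by move=> a b; apply: rpredD.
- by move=> r a Ia; exact: (rpredZ r Ia).
Qed.

Lemma mem_idealr (I : idealr R) : is_ideal [set a | a \in I].
Proof.
split; first exact: idealr0.
- by move=> a b; apply: rpredD.
- by move=> r a; apply: idealMr.
Qed.

Lemma val_lincomb (J : ideal R) n (c : 'I_n -> R) (v : 'I_n -> submodule J) :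
  val (\sum_i c i *: v i) = \sum_i c i * val (v i).
Proof.
apply: (big_ind2 (fun u (a : R) => val u = a)) => // u a w b ua wb.
by rewrite -ua -wb.
Qed.

Lemma ideal_of_set I :
  is_ideal I -> exists J : ideal R, forall a, (a \in J) = `[< I a >].
Proof.
case=> I0 ID IM; pose P : {pred R^o} := fun a => `[< I a >].
have cP : subsemimod_closed P.
  split; first by split=> [|a b /asboolP Ia /asboolP Ib];
    apply/asboolP => //; apply: ID.
  by move=> r a /asboolP Ia; apply/asboolP/IM.
pose cl := GRing.isSubmodClosed.Build R R^o P cP.
have @K : ideal R := HB.pack P cl. by exists K.
Qed.

Lemma idealr_of_set I : is_ideal I -> ~ I 1 ->
  exists J : idealr R, forall a, (a \in J) = `[< I a >].
Proof.
case=> I0 ID IM I1; pose P : {pred R} := fun a => `[< I a >].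
have cP : idealr_closed P.
  split; [exact/asboolP|exact/asboolP|].
  move=> r a b /asboolP Ia /asboolP Ib; apply/asboolP; apply: ID => //.
  exact: IM.
pose cl := isIdealr.Build R P cP.
have @K : idealr R := HB.pack P cl. by exists K.
Qed.

Lemma prime_idealr_of_set P : is_prime P ->
  exists J : prime_idealr R, forall a, (a \in J) = `[< P a >].
Proof.
case=> [[P0 PD PM] P1 PP]; pose Q : {pred R} := fun a => `[< P a >].
have cQ : idealr_closed Q.
  split; [exact/asboolP|exact/asboolP|].
  move=> r a b /asboolP Pa /asboolP Pb; apply/asboolP; apply: PD => //.
  exact: PM.
have cP : prime_idealr_closed Q.
  by move=> a b /asboolP/PP[Pa|Pb]; apply/orP; [left|right]; apply/asboolP.
pose cl := isIdealr.Build R Q cQ.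
pose cl' := isPrimeIdealrClosed.Build R Q cP.
have @K : prime_idealr R := HB.pack Q cl cl'. by exists K.
Qed.

End SetIdeals.

(** * Noetherian induction and the existence of prime ideals *)

Section Noetherian.
Variable R : comNzRingType.
Hypothesis noethR : noetherian R.
Implicit Types (I J P : set R) (a b r : R).

Lemma ideal_generated I : is_ideal I ->
  exists n (v : 'I_n -> R), (forall i, I (v i)) /\
    forall a, I a -> exists c : 'I_n -> R, a = \sum_i c i * v i.
Proof.
move=> idI; have [J eqJ] := ideal_of_set idI.
have [n [v vP]] := noethR J; exists n, (fun i => \val (v i)); split.
  by move=> i; have := valP (v i); rewrite eqJ => /asboolP.
move=> a Ia; have Ja : a \in J by rewrite eqJ; apply/asboolP.
have [c /(congr1 val) cP] := vP (Submodule Ja); exists c.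
by rewrite -val_lincomb -cP.
Qed.

(** A failing ideal would start, by choice, a strictly increasing chain of failing ideals; the
    finitely many generators of its union already lie in one term. *)
Lemma noetherian_ind (Q : set R -> Prop) :
  (forall I, is_ideal I ->
    (forall J, is_ideal J -> I `<=` J -> ~ J `<=` I -> Q J) -> Q I) ->
  forall I, is_ideal I -> Q I.
Proof.
move=> QS I idI; apply: contrapT => nQI.
pose bad := {I | is_ideal I /\ ~ Q I}.
have step (t : bad) : exists t' : bad, sval t `<=` sval t' /\ ~ sval t' `<=` sval t.
  case: t => J [idJ nQJ]; apply: contrapT => nstep; apply: (nQJ); apply: QS =>
    // K idK JK nKJ.
  by apply: contrapT => nQK; apply: nstep; exists (exist _ K (conj idK nQK)).
have [f fP] := choice step.
pose u n := sval (iter n f (exist _ I (conj idI nQI))).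
have idu n : is_ideal (u n) by rewrite /u;
  case: (svalP (iter n f (exist _ I (conj idI nQI)))).
have uS n : u n `<=` u n.+1 /\ ~ u n.+1 `<=` u n by apply: fP.
have umono n p : (n <= p)%N -> u n `<=` u p.
  elim: p => [|p IHp]; first by rewrite leqn0 => /eqP->.
  rewrite leq_eqVlt => /predU1P[->//|/IHp np].
  exact: subset_trans np (uS p).1.
pose U : set R := [set a | exists n, u n a].
have idU : is_ideal U.
  split; first by exists 0%N; apply: ideal0.
  - move=> a b [n una] [p upb]; exists (maxn n p); apply: idealD => //.
      by apply: umono una; apply: leq_maxl.
    by apply: umono upb; apply: leq_maxr.
  - by move=> r a [n una]; exists n; apply: idealMl.
have [n [v [Uv genU]]] := ideal_generated idU.
have [k kP] := choice Uv.
case: (uS (\max_i k i)) => _; apply=> a una.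
have [|c ->] := genU a; first by exists (\max_i k i).+1.
apply: ideal_sum => // i; apply: idealMl => //.
by apply: umono (kP i); apply: leq_bigmax.
Qed.

Lemma noetherian_adjoin_ind (Q : set R -> Prop) :
  (forall I, is_ideal I -> (forall a, ~ I a -> Q (adjoin I a)) -> Q I) ->
  forall I, is_ideal I -> Q I.
Proof.
move=> QS; apply: noetherian_ind => I idI IH; apply: QS => // a nIa.
apply: IH; [exact: adjoin_ideal|exact: sub_adjoin|].
by move=> /(_ a (mem_adjoin _ idI)).
Qed.

(** An ideal maximal among those disjoint from the multiplicative set [T] is prime; Noetherian
    induction takes the place of Zorn's lemma. *)
Lemma prime_avoiding (T J : set R) :
  T 1 -> (forall a b, T a -> T b -> T (a * b)) -> is_ideal J ->
  (forall a, J a -> ~ T a) ->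
  exists P, [/\ is_prime P, J `<=` P & forall a, P a -> ~ T a].
Proof.
move=> T1 TM; move: J; apply: noetherian_adjoin_ind => J idJ IH JT.
have [[a [nJa aT]]|noa] := pselect (exists a, ~ J a /\ forall b, adjoin J a b -> ~ T b).
  have [P [pP JaP PT]] := IH a nJa aT; exists P; split=> //.
  exact: subset_trans (@sub_adjoin _ _ _) JaP.
have meet a : ~ J a -> exists b, adjoin J a b /\ T b.
  move=> nJa; apply: contrapT => nob; apply: noa; exists a; split=> // b Jab Tb.
  by apply: nob; exists b.
exists J; split=> //; split=> // [J1|a b Jab]; first exact: JT J1 T1.
(* If neither factor is in J, then J + Ra and J + Rb both meet [T]; the product of the two elements
   found is in [T], and in J because ab is. *)
apply: contrapT => /not_orP[/meet[_ [[i [r [Ji ->]]] Ta]] /meet[_ [[j [s [Jj ->]]] Tb]]].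
apply: JT (TM _ _ Ta Tb).
have -> : (i + r * a) * (j + s * b) = (j + s * b) * i + (r * a) * j + r * s * (a * b)
  by ring.
by apply: idealD => //; [apply: idealD => //|]; apply: idealMl.
Qed.

(* The colon ideals (I : b a) are proper, and a maximal one is prime. *)
Lemma associated_prime I a : is_ideal I -> ~ I a ->
  exists b, ~ I (b * a) /\ is_prime (quo I (b * a)).
Proof.
move=> idI nIa.
suff H J : is_ideal J -> forall a, ~ I a -> J = quo I a ->
    exists b, ~ I (b * a) /\ is_prime (quo I (b * a)).
  exact: H (quo_ideal a idI) a nIa erefl.
move: J {a nIa}; apply: noetherian_ind => J idJ IH a nIa eJ.
have [pJ|] := pselect (forall u v, quo I a (u * v) -> quo I a u \/ quo I a v).
  exists 1; rewrite mul1r; split=> //; split=> //; first exact: quo_ideal.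
  by rewrite /quo /= mul1r.
move=> /existsNP[u /existsNP[v /not_implyP[Iuv /not_orP[nIu nIv]]]].
have [||||b [nI pI]] := IH (quo I (v * a)) _ _ _ (v * a) _ erefl.
- exact: quo_ideal.
- by rewrite eJ /quo => r /= Ir; rewrite mulrCA; apply: idealMl.
- by move=> /(_ u); rewrite eJ /quo /= mulrA; move=> /(_ Iuv).
- by [].
by exists (b * v); rewrite -mulrA.
Qed.

End Noetherian.

(** * Local rings: Nakayama's lemma and dimension one *)

Section Local.
Local Open Scope quotient_scope.
Variables (R : comNzRingType) (m : idealr R).
Hypotheses (noethR : noetherian R) (locR : local_ring m).
Implicit Types (I J P : set R) (a b r : R).

Lemma proper_sub_local I a : is_ideal I -> ~ I 1 -> I a -> a \in m.
Proof.
move: I; apply: (noetherian_ind noethR) => I idI IH I1 Ia.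
have [[J [idJ IJ nJI J1]]|noJ] :=
    pselect (exists J, [/\ is_ideal J, I `<=` J, ~ J `<=` I & ~ J 1]).
  by apply: (IH J) => //; apply: IJ.
have [J eqJ] := idealr_of_set idI I1.
suff maxJ : maximal_ideal J by rewrite -(locR.2 J maxJ) eqJ; apply/asboolP.
move=> K JK b; apply/idP/idP; last exact: JK.
move=> Kb; rewrite eqJ; apply/asboolP; apply: contrapT => nIb; apply: noJ.
exists [set c | c \in K]; split; first exact: mem_idealr.
- by move=> c Ic /=; apply: JK; rewrite eqJ; apply/asboolP.
- by move=> /(_ b Kb).
- by rewrite /= idealr1.
Qed.

Lemma local_unit a : a \notin m -> exists b, b * a = 1.
Proof.
move=> ma; apply: contrapT => na.
have : a \in m; last exact/negP.
apply: (@proper_sub_local [set a * r | r in [set: R]]).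
- exact: principal_ideal.
- by move=> [b _ ab]; apply: na; exists b; rewrite mulrC.
- by exists 1; rewrite ?mulr1.
Qed.

Lemma local_prime : is_prime [set a | a \in m].
Proof.
split; [exact: mem_idealr|by rewrite /= idealr1|].
move=> a b /= mab; apply/orP; have [//|/local_unit[c ca]] := boolP (a \in m).
by rewrite -[b]mul1r -ca -mulrA idealMr.
Qed.

Lemma residue_field :
  exists (k : fieldType) (f : {rmorphism R -> k}),
    (forall a, f a = 0 <-> a \in m) /\ forall y, exists a, f a = y.
Proof.
pose Q := {ideal_quot m}.
have pi0 a : (\pi_Q a = 0) <-> a \in m.
  rewrite -[0](rmorph0 (\pi_Q : {rmorphism R -> Q})) -[a in X in _ <-> X]subr0.
  by rewrite Quotient.idealrBE; split=> [->|/eqP].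
have invP (y : Q) : exists z, y != 0 -> z * y = 1.
  have [->|] := eqVneq y 0; first by exists 0.
  have <- : \pi_Q (repr y) = y by rewrite reprK.
  move=> /eqP/pi0/negP/local_unit[b ba]; exists (\pi_Q b) => _.
  by rewrite -rmorphM ba rmorph1.
have [inv0 inv0P] := choice invP.
pose inv (y : Q) := if y == 0 then 0 else inv0 y.
have mulV (y : Q) : y != 0 -> inv y * y = 1.
  by move=> y0; rewrite /inv (negPf y0); apply: inv0P.
have invo : inv 0 = 0 by rewrite /inv eqxx.
pose cl := GRing.ComNzRing_isField.Build Q mulV invo.
have @k : fieldType := HB.pack Q cl.
pose f : {rmorphism R -> k} := \pi_Q.
by exists k, f; split=> // y; exists (repr (y : Q)); apply: reprK.
Qed.

(* The determinant of [1 - M] is a unit when [M] has its entries in [m]. *)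
Lemma nakayama n (v : 'I_n -> R) (M : 'I_n -> 'I_n -> R) I :
  is_ideal I -> (forall i j, M i j \in m) ->
  (forall i, I (v i - \sum_j M i j * v j)) -> forall i, I (v i).
Proof.
move=> idI Mm Iv i.
pose A : 'M[R]_n := 1%:M - \matrix_(i, j) M i j.
pose w : 'cV[R]_n := \col_j v j.
have Aw j : I ((A *m w) j 0).
  rewrite mulmxBl mul1mx !mxE; under eq_bigr do rewrite !mxE.
  exact: Iv.
have IAv : I (\det A * v i).
  have -> : \det A * v i = (\adj A *m (A *m w)) i 0.
    by rewrite mulmxA mul_adj_mx mul_scalar_mx !mxE.
  by rewrite mxE; apply: ideal_sum => // j; apply: idealMl.
have /local_unit[b bA] : \det A \notin m.
  have [k [f [f0 _]]] := residue_field.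
  apply/negP => /f0; rewrite -det_map_mx map_mxB map_mx1.
  have -> : map_mx f (\matrix_(i, j) M i j) = 0.
    by apply/matrixP => j l; rewrite !mxE; apply/f0.
  by rewrite subr0 det1 => /eqP; rewrite oner_eq0.
by rewrite -[v i]mul1r -bA -mulrA; apply: idealMl.
Qed.

Lemma nakayama_principal x I J :
  x \in m -> is_ideal I -> is_ideal J ->
  (forall a, J a -> exists2 b, J b & I (a - x * b)) -> J `<=` I.
Proof.
move=> mx idI idJ JIx.
have [n [v [Jv genJ]]] := ideal_generated noethR idJ.
have Iv i : I (v i).
  have /choice[c cP] j : exists c : 'I_n -> R, I (v j - \sum_l x * c l * v l).
    have [b /genJ[c ->] Ib] := JIx _ (Jv j); exists c.
    by under eq_bigr do rewrite -mulrA; rewrite -mulr_sumr.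
  apply: (@nakayama _ v (fun j l => x * c j l) I) => // j l.
  by rewrite mulrC idealMr.
by move=> a /genJ[c ->]; apply: ideal_sum => // i; apply: idealMl.
Qed.

(* Modulo the lowest unit coefficient of u, the coefficients of h would lie in
   m times the ideal they generate. *)
Lemma unit_content_reg (u h : {poly R}) i :
  u`_i \notin m -> u * h = 0 -> h = 0.
Proof.
move=> ui uh0.
have [e ue emin] := ex_minnP (ex_intro (fun i => u`_i \notin m) i ui).
have um j : (j < e)%N -> u`_j \in m.
  by move=> je; apply: contraLR je => /emin; rewrite -leqNgt.
have [b bu] := local_unit ue.
have hM l : exists c : 'I_(size h) -> R,
    (forall j, c j \in m) /\ h`_l = \sum_j c j * h`_j.
  elim/ltn_ind: l => l IHl.
  pose mH := [set a | exists c : 'I_(size h) -> R,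
    (forall j, c j \in m) /\ a = \sum_j c j * h`_j].
  have idH : is_ideal mH.
    split; first by exists (fun=> 0); split=> [j|]; rewrite ?idealr0 // big1 // => j _;
      rewrite mul0r.
    - move=> _ _ [c [cm ->]] [d [dm ->]]; exists (fun j => c j + d j); split.
        by move=> j; apply: rpredD.
      by rewrite -big_split; apply: eq_bigr => j _; rewrite mulrDl.
    - move=> r _ [c [cm ->]]; exists (fun j => r * c j); split.
        by move=> j; apply: idealMr.
      by rewrite mulr_sumr; apply: eq_bigr => j _; rewrite mulrA.
  have mHm c j : c \in m -> mH (c * h`_j).
    move=> mc; have [jh|jh] := ltnP j (size h); last first.
      by rewrite nth_default // mulr0; apply: ideal0.
    exists (fun k => if k == Ordinal jh then c else 0); split.
      by move=> k; case: ifP => // _; apply: idealr0.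
    rewrite (bigD1 (Ordinal jh)) //= eqxx big1 ?addr0 // => k /negPf->.
    by rewrite mul0r.
  (* In degree [e + l], the terms with j < e have u_j in m, and those with j > e involve a
     coefficient of [h] of index below [l], settled by induction; the remaining term is a unit times
     h_l. *)
  have : (u * h)`_(e + l) = 0 by rewrite uh0 coef0.
  rewrite coefM (bigD1 (inord e)) //= inordK ?ltnS ?leq_addr // addKn => uhe.
  suff : mH (b * (u`_e * h`_l)) by rewrite mulrA bu mul1r.
  apply: idealMl => //; move/eqP: uhe; rewrite addr_eq0 => /eqP->.
  apply: idealN => //; apply: (big_ind mH) => [||j /eqP je].
  - exact: ideal0.
  - by move=> ? ?; apply: idealD.
  have [/um/mHm//|ej] := ltnP j e.
  apply: idealMl => //; apply: IHl.
  have : (j : nat) != e by apply/eqP => e_j; apply: je; apply: val_inj;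
    rewrite /= inordK // ltnS leq_addr.
  have := ltn_ord j; lia.
apply/polyP => l; rewrite coef0.
have [lh|] := ltnP l (size h); last exact: nth_default.
have [c cP] := choice hM.
apply: (@nakayama _ (fun j : 'I_(size h) => h`_j) (fun j =>
  c j) [set 0] _ _ _ (Ordinal lh)).
- exact: set0_ideal.
- by move=> j k; case: (cP j).
- by move=> j /=; case: (cP j) => _ <-; rewrite subrr.
Qed.

Hypothesis dim1 : krull_dim R^o 1.

Lemma no_prime_chain2 (P Q : set R) : is_prime P -> is_prime Q ->
  P `<=` Q -> ~ Q `<=` P -> (forall a, a \in m -> Q a).
Proof.
move=> pP pQ PQ nQP; apply: contrapT => /existsNP[z /not_implyP[mz nQz]].
have [P' eP] := prime_idealr_of_set pP.
have [Q' eQ] := prime_idealr_of_set pQ.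
have [m' em] := prime_idealr_of_set local_prime.
have : prime_chain R^o 2.
  exists (fun i => if i is i'.+1 then if i' is 0%N then Q' else m' else P').
  split=> [a a0|[|[|//]] _].
  - have /= := a0 1; rewrite eP => a10; apply/asboolP.
    have -> : a = 0 by rewrite -a10; exact: esym (mulr1 a).
    by case: pP => idP _ _; apply: ideal0.
  - split=> [a|QP]; first by rewrite eP eQ => /asboolP/PQ/asboolP.
    apply: nQP => a Qa; apply/asboolP; rewrite -eP; apply: QP.
    by rewrite eQ; apply/asboolP.
  - split=> [a|/(_ z)]; last by rewrite em eQ => /(_ (asboolT mz))/asboolP.
    rewrite em eQ => /asboolP Qa; apply/asboolP => /=.
    by case: pQ => idQ Q1 _; apply: proper_sub_local idQ Q1 Qa.
by move=> /dim1.2.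
Qed.

(* Otherwise a prime ideal avoiding all the s p^k would lie strictly below P. *)
Lemma nonmaximal_prime_torsion P p z :
  is_prime P -> z \in m -> ~ P z -> P p ->
  exists k s, ~ P s /\ s * p ^+ k = 0.
Proof.
move=> pP mz nPz Pp; apply: contrapT => nks.
have [idP P1 PP] := pP.
pose T : set R := [set a | exists k s, ~ P s /\ a = s * p ^+ k].
have [||||Q [pQ _ QT]] := @prime_avoiding _ noethR T [set 0].
- by exists 0%N, 1; rewrite expr0 mulr1.
- move=> _ _ [k [s [Ps ->]]] [l [t [Pt ->]]]; exists (k + l)%N, (s * t).
  by split; [move=> /PP[]|rewrite exprD mulrACA].
- exact: set0_ideal.
- by move=> _ /= -> [k [s [Ps /esym sp]]]; apply: nks; exists k, s.
apply: nPz; apply: (no_prime_chain2 pQ pP) => // [a Qa|PQ].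
  by apply: contrapT => nPa; apply: (QT a Qa); exists 0%N, a; rewrite expr0 mulr1.
by apply: (QT p (PQ p Pp)); exists 1%N, 1; rewrite mul1r expr1.
Qed.

Section RegularElement.
Variable x : R.
Hypotheses (mx : x \in m) (regx : forall a, x * a = 0 -> a = 0).

Lemma regX k a : x ^+ k * a = 0 -> a = 0.
Proof. by elim: k => [|k IHk]; rewrite ?expr0 ?mul1r // exprS -mulrA => /regx. Qed.

(** Otherwise [nonmaximal_prime_torsion] gives s x^k = 0 with s outside P, and regularity of [x]
    forces s = 0. *)
Lemma prime_over_regular P a : is_prime P -> P x -> a \in m -> P a.
Proof.
move=> pP Px ma; apply: contrapT => nPa.
have [k [s [nPs]]] := nonmaximal_prime_torsion pP ma nPa Px.
rewrite mulrC => /regX s0; apply: nPs; rewrite s0.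
by case: pP => idP _ _; apply: ideal0.
Qed.

(** An associated prime of R/I contains [x], hence m, so [b * a] represents a nonzero socle element
    of R/I. *)
Lemma socle_mod_regular I a : is_ideal I -> I x -> ~ I a ->
  exists b, ~ I (b * a) /\ forall r, r \in m -> I (r * (b * a)).
Proof.
move=> idI Ix nIa; have [b [nI pI]] := associated_prime noethR idI nIa.
exists b; split=> // r mr.
suff : quo I (b * a) r by [].
by apply: prime_over_regular mr => //; rewrite /quo /= mulrC; apply: idealMl.
Qed.

(** Induction along a composition series of R/I: each step divides R/I by a copy of R/m in its
    socle. *)
Lemma regular_ind (Q : set R -> Prop) :
  (forall I, is_ideal I -> I 1 -> Q I) ->
  (forall I a, is_ideal I -> I x -> ~ I a -> (forall r, r \in m -> I (r * a)) ->
     Q (adjoin I a) -> Q I) ->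
  forall I, is_ideal I -> I x -> Q I.
Proof.
move=> Q1 QS; apply: (noetherian_adjoin_ind noethR) => I idI IH Ix.
have [I1|nI1] := pselect (I 1); first exact: Q1.
have [b [nIb mIb]] := socle_mod_regular idI Ix nI1.
by apply: QS mIb _ => //; apply: IH => //; apply: sub_adjoin.
Qed.

(* A prime ideal over J avoiding the powers of x would be minimal, hence
   consist of zerodivisors, and some s != 0 would kill all generators of J. *)
Lemma faithful_ideal_regular J : is_ideal J ->
  (forall a, (forall j, J j -> a * j = 0) -> a = 0) -> exists k, J (x ^+ k).
Proof.
move=> idJ faithJ; apply: contrapT => /forallNP Jx.
have [||||P [pP JP Px]] := @prime_avoiding _ noethR [set x ^+ k | k in setT] J.
- by exists 0%N.
- by move=> _ _ [k _ <-] [l _ <-]; exists (k + l)%N; rewrite // exprD.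
- by [].
- by move=> a Ja [k _ ax]; apply: (Jx k); rewrite ax.
have [idP P1 PP] := pP.
have [n [v [Jv genJ]]] := ideal_generated noethR idJ.
have nPx : ~ P x by move=> /Px; apply; exists 1%N; rewrite ?expr1.
have killed (s : seq 'I_n) : exists t, ~ P t /\ exists k, forall i, i \in s -> t * v i
  ^+ k = 0.
  elim: s => [|i s [t [nPt [k tk]]]]; first by exists 1; split=> //; exists 0%N.
  have [l [u [nPu ul]]] := nonmaximal_prime_torsion pP mx nPx (JP _ (Jv i)).
  exists (u * t); split; first by move=> /PP[].
  exists (l + k)%N => j; rewrite inE exprD mulrACA => /orP[/eqP->|/tk->].
    by rewrite ul mul0r.
  by rewrite mulr0.
have [t [nPt [k tk]]] := killed (enum 'I_n).
have t0 : t != 0 by apply/eqP => t0; apply: nPt; rewrite t0; apply: ideal0.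
(* Going through the generators, the current element is multiplied by the highest power of v_i that
   does not kill it. Such a power exists because the k-th one kills, a property that is
   preserved. *)
have [u [u0 uv]] : exists u, u != 0 /\ forall i, u * v i = 0.
  have tk' i : t * v i ^+ k = 0 by apply: tk; rewrite mem_enum.
  suff [u [u0 [_ uv]]] : exists u, u != 0 /\
      (forall i, u * v i ^+ k = 0) /\ forall i, i \in enum 'I_n -> u * v i = 0.
    by exists u; split=> // i; apply: uv; rewrite mem_enum.
  elim: (enum 'I_n) => [|i s [u [u0 [uk us]]]]; first by exists t.
  have [e ue emin] := ex_minnP (ex_intro (fun e =>
    u * v i ^+ e == 0) k (introT eqP (uk i))).
  case: e ue emin => [|e] ue emin; first by rewrite expr0 mulr1 (negPf u0) in ue.
  exists (u * v i ^+ e); split; first by apply/negP => /emin; rewrite ltnn.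
  split=> [j|j]; first by rewrite mulrAC uk mul0r.
  rewrite inE => /orP[/eqP->|/us uj]; first by rewrite -mulrA -exprSr; apply/eqP.
  by rewrite mulrAC uj mul0r.
case/eqP: u0; apply: faithJ => _ /genJ[c ->].
by rewrite mulr_sumr big1 // => i _; rewrite mulrCA uv mulr0.
Qed.

End RegularElement.
End Local.

Lemma linear_of_fun (R : nzRingType) (U V : lmodType R) (f : U -> V) :
  (forall a u v, f (a *: u + v) = a *: f u + f v) ->
  exists g : {linear U -> V}, forall u, g u = f u.
Proof.
move=> lf; pose cl := GRing.isLinear.Build R U V *:%R f lf.
have @g : {linear U -> V} := HB.pack f cl.
by exists g.
Qed.

(** * Maps from ideals and cyclic modules into injective modules *)

Section InjectiveModules.
Variable R : comNzRingType.
Implicit Types (J : set R) (a r : R).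

(** Baer's form of injectivity, [v] being the image of 1 under an extension. Linearity of [g] is
    asked on [J] only, so that choice functions can serve. *)
Lemma injective_extend (E : lmodType R) J (g : R -> E) :
  injective_module E -> is_ideal J ->
  (forall a b, J a -> J b -> g (a + b) = g a + g b) ->
  (forall r a, J a -> g (r * a) = r *: g a) ->
  exists v, forall a, J a -> a *: v = g a.
Proof.
move=> injE idJ gD gZ; have [J' eJ] := ideal_of_set idJ.
have JJ (u : submodule J') : J (val u) by apply/asboolP; rewrite -eJ; apply: valP.
have [i iE] := @linear_of_fun R (submodule J') R^o val (fun _ _ _ => erefl).
have [|f fE] := @linear_of_fun R (submodule J') E (fun u => g (val u)).
  by move=> a u v; rewrite (gD (a * val u)) ?gZ //; apply: idealMl.
have [|h hE] := injE _ _ i f; first by move=> u v; rewrite !iE => /val_inj.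
exists (h 1) => a Ja; have Ja' : a \in J' by rewrite eJ; apply/asboolP.
rewrite -linearZ /=; have := hE (Submodule Ja'); rewrite iE fE /= => <-.
by congr (h _); apply: mulr1.
Qed.

(** Extends the map (J + Ra)/J -> E that sends the class of [a] to [y] to all of R/J; the hypothesis
    says that this map is well defined. *)
Lemma injective_extend_cyclic (E : lmodType R) J a (y : E) :
  injective_module E -> is_ideal J -> (forall r, J (r * a) -> r *: y = 0) ->
  exists v, a *: v = y /\ forall j, J j -> j *: v = 0.
Proof.
move=> injE idJ ay.
(* [c b] is a coefficient of [a] in [b] modulo [J]; by [wd] its choice does not affect
   [c b *: y]. *)
have /choice[c cP] b : exists r, adjoin J a b -> J (b - r * a).
  have [[i [r [Ji ->]]]|nb] := pselect (adjoin J a b); last by exists 0.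
  by exists r; rewrite addrK.
have wd b r : J (b - r * a) -> c b *: y = r *: y.
  move=> Jb; apply/eqP; rewrite -subr_eq0 -scalerBl; apply/eqP/ay.
  have /cP Jc : adjoin J a b by exists (b - r * a), r; rewrite subrK.
  have -> : (c b - r) * a = (b - r * a) - (b - c b * a) by ring.
  exact: idealB.
have [|b b'|r b|v vP] := @injective_extend E (adjoin J a) (fun b => c b *: y) injE.
- exact: adjoin_ideal.
- move=> /cP Jb /cP Jb'; rewrite -scalerDl; apply: wd.
  have -> : b + b' - (c b + c b') * a = (b - c b * a) + (b' - c b' * a) by ring.
  exact: idealD.
- move=> /cP Jb; rewrite scalerA; apply: wd.
  by rewrite -mulrA -mulrBr; apply: idealMl.
exists v; split=> [|j Jj]; rewrite vP.
- by rewrite (@wd _ 1) ?scale1r // mul1r subrr; apply: ideal0.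
- exact: mem_adjoin.
- by rewrite (@wd _ 0) ?scale0r // mul0r subr0.
- exact: sub_adjoin.
Qed.

Lemma injective_divisible (E : lmodType R) x (y : E) :
  injective_module E -> (forall a, x * a = 0 -> a = 0) ->
  exists v, x *: v = y.
Proof.
move=> injE regx.
have [|r /= |v [<- _]] := @injective_extend_cyclic E [set 0] x y injE.
- exact: set0_ideal.
- by rewrite mulrC => /regx->; rewrite scale0r.
- by exists v.
Qed.

End InjectiveModules.

(** * Vanishing of Ext, and Ext^1 read modulo x *)

Section Canonical.
Variables (R : comNzRingType) (m : idealr R).
Hypotheses (noethR : noetherian R) (locR : local_ring m) (dim1 : krull_dim R^o 1).
Variable x : R.
Hypotheses (mx : x \in m) (regx : forall a, x * a = 0 -> a = 0).
Implicit Types (J I : set R) (a r : R).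

Let xR : set R := [set x * r | r in [set: R]].

Lemma principal_proper : ~ xR 1.
Proof.
move=> [r _ xr]; have : (1 : R) \in m; last by rewrite idealr1.
by rewrite -xr mulrC idealMr.
Qed.

Lemma socle_principal : exists s, ~ xR s /\ forall r, r \in m -> xR (r * s).
Proof.
have idxR : is_ideal xR by exact: principal_ideal.
have [|s] := socle_mod_regular noethR locR dim1 regx idxR _ principal_proper.
  by exists 1; rewrite ?mulr1.
by rewrite mulr1 => sP; exists s.
Qed.

Definition killed (M : lmodType R) J (y : M) := forall j, J j -> j *: y = 0.

Lemma killed_adjoin (M : lmodType R) J a (y : M) :
  killed J y -> a *: y = 0 -> killed (adjoin J a) y.
Proof.
by move=> Jy ay _ [j [r [Jj ->]]]; rewrite scalerDl -scalerA ay scaler0 addr0 Jy.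
Qed.

Lemma killedS (M : lmodType R) J I (y : M) : I `<=` J -> killed J y -> killed I y.
Proof. by move=> IJ Jy j /IJ; apply: Jy. Qed.

Lemma killedD (M : lmodType R) J (y z : M) : killed J y -> killed J z -> killed J (y + z).
Proof. by move=> Jy Jz j Jj; rewrite scalerDr Jy ?Jz ?addr0. Qed.

Lemma killedB (M : lmodType R) J (y z : M) : killed J y -> killed J z -> killed J (y - z).
Proof. by move=> Jy Jz j Jj; rewrite scalerBr Jy ?Jz ?subr0. Qed.

Section Resolution.
Variables (W : lmodType R) (X : injective_resolution W).
Hypothesis regW : forall w : W, x *: w = 0 -> w = 0.

Notation d := (res_d X).
Notation aug := (res_aug X).

Lemma res_augZ r w : aug (r *: w) = r *: aug w. Proof. exact: linearZ. Qed.

Lemma res_dd i y : d i.+1 (d i y) = 0.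
Proof. by apply/res_exactS; exists y. Qed.

Lemma res_d_aug w : d 0%N (aug w) = 0.
Proof. by apply/res_exact0; exists w. Qed.

(* Ext^(i+1)(R/J, W) = 0 *)
Definition ext_vanishes i J := forall y : res_obj X i.+1,
  d i.+1 y = 0 -> killed J y -> exists z, killed J z /\ d i z = y.

(** If y = d w is killed by [x], then x w is a coboundary d v; since v is divisible by [x] in an
    injective module, subtracting a coboundary from w makes it killed by [x]. *)
Lemma ext_vanishes_regular i : ext_vanishes i.+1 xR.
Proof.
move=> y dy Jy; have [w wy] := (res_exactS y).1 dy.
have xy : x *: y = 0 by apply: Jy; exists 1; rewrite ?mulr1.
have [v vw] : exists v, d i v = x *: w.
  by apply/res_exactS; rewrite linearZ /= wy.
have [v' vv'] := injective_divisible v (@res_injective _ _ X (i)) regx.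
exists (w - d i v'); split; last by rewrite raddfB /= wy res_dd subr0.
move=> _ [r _ <-]; rewrite mulrC -scalerA scalerBr -linearZ /= vv' vw subrr.
by rewrite scaler0.
Qed.

(** A socle element [s] embeds R/m into R/xR with cokernel R/(xR + Rs). Ext of R/xR vanishes in this
    degree and Ext of the cokernel in the next, hence Ext of R/m vanishes; a composition series
    extends this to R/J. *)
Lemma ext_vanishes_step i :
  (forall J, is_ideal J -> J x -> ext_vanishes i.+2 J) ->
  forall J, is_ideal J -> J x -> ext_vanishes i.+1 J.
Proof.
move=> IH.
have Vm : ext_vanishes i.+1 [set a | a \in m].
  move=> y dy my; have [s [nxs ms]] := socle_principal.
  have [|r xrs|y' [sy' xy']] :=
    @injective_extend_cyclic R _ xR s y (@res_injective _ _ X (i.+2)).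
  - exact: principal_ideal.
  - apply: my => /=; apply/negPn/negP => /(local_unit noethR locR)[b br].
    apply: nxs; rewrite -[s]mul1r -br -mulrA.
    by apply: idealMl => //; apply: principal_ideal.
  have Jy' : killed (adjoin xR s) (d i.+2 y').
    apply: killed_adjoin; last by rewrite -linearZ /= sy'.
    by move=> j xj; rewrite -linearZ /= xy' // linear0.
  have [||z [Jz dz]] := IH (adjoin xR s) _ _ _ (res_dd _) Jy'.
  - exact/adjoin_ideal/principal_ideal.
  - by apply: sub_adjoin; exists 1; rewrite ?mulr1.
  have [||w [xw dw]] := @ext_vanishes_regular i (y' - z).
    + by rewrite raddfB /= dz subrr.
    + by apply: killedB => //; apply: killedS Jz; apply: sub_adjoin.
  (* The map on R/xR given by [w], restricted to R/m along the embedding 1 -> s. *)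
  exists (s *: w); split.
    by move=> r /ms [t _ rs]; rewrite scalerA -rs; apply: xw; exists t.
  rewrite linearZ /= dw scalerBr sy' (Jz s) ?subr0 //.
  exact/mem_adjoin/principal_ideal.
apply: (regular_ind noethR locR dim1 regx) => [J idJ J1 y dy Jy|].
  exists 0; split; first by move=> j _; rewrite scaler0.
  by rewrite linear0 -[y]scale1r Jy.
move=> J a idJ Jx nJa ma Va y dy Jy.
have [||z [mz dz]] := Vm (a *: y).
- by rewrite linearZ /= dy scaler0.
- by move=> r /ma; rewrite scalerA; apply: Jy.
have [|z' [az' Jz']] :=
  @injective_extend_cyclic R _ J a z (@res_injective _ _ X (i.+1)) idJ.
  move=> r Jra; apply: mz; apply/negPn/negP => /(local_unit noethR locR)[b br].
  by apply: nJa; rewrite -[a]mul1r -br -mulrA; apply: idealMl.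
have [||z'' [Jz'' dz'']] := Va (y - d i.+1 z').
- by rewrite raddfB /= dy res_dd subr0.
- apply: killed_adjoin; last by rewrite scalerBr -dz -az' linearZ subrr.
  by apply: killedB => // j Jj; rewrite -linearZ /= Jz' // linear0.
exists (z' + z''); split; last by rewrite raddfD /= dz'' addrC subrK.
by apply: killedD => //; apply: killedS Jz''; apply: sub_adjoin.
Qed.

Lemma ext_vanishes2 n : (forall i, (n < i)%N -> forall y : res_obj X i, y = 0) ->
  forall J, is_ideal J -> J x -> ext_vanishes 1 J.
Proof.
move=> X0.
suff H k : forall i, (n < k + i)%N -> forall J, is_ideal J -> J x -> ext_vanishes i.+1 J.
  by apply: (H n.+1); rewrite addn0.
elim: k => [|k IHk] i ni; last first.
  by apply: ext_vanishes_step; apply: IHk; rewrite addnS -addSn.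
move=> J idJ Jx y dy Jy; exists 0; split; first by move=> j _; rewrite scaler0.
by rewrite linear0 (X0 i.+2 _ y) //; lia.
Qed.

Definition divx (w : W) := exists w', w = x *: w'.

Lemma divxD v w : divx v -> divx w -> divx (v + w).
Proof. by move=> [v' ->] [w' ->]; exists (v' + w'); rewrite scalerDr. Qed.
Lemma divxZ r w : divx w -> divx (r *: w).
Proof. by move=> [w' ->]; exists (r *: w'); rewrite !scalerA mulrC. Qed.
Lemma divxB v w : divx v -> divx w -> divx (v - w).
Proof. by move=> dv dw; rewrite -scaleN1r; apply/divxD/divxZ. Qed.

(* The next lemmas describe Ext^1(R/J, W) = Hom(R/J, W/xW) for J containing x:
   the class of w is that of the cocycle d v, where w = x v. *)
Lemma divx_cocycle J w : is_ideal J -> J x -> (forall j, J j -> divx (j *: w)) ->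
  exists v, aug w = x *: v /\ forall j, J j -> exists w', j *: v = aug w'.
Proof.
move=> idJ Jx Jw.
have /choice[g gP] j : exists w', J j -> j *: w = x *: w'.
  have [/Jw[w' ->]|nJj] := pselect (J j); first by exists w'.
  by exists 0.
have inj (u v : W) : x *: u = x *: v -> u = v.
  by move=> e; apply: subr0_eq; apply: regW; rewrite scalerBr e subrr.
have [||v vP] := @injective_extend R _ J (fun j =>
  aug (g j)) (@res_injective _ _ X (0)) idJ.
- move=> a b Ja Jb; rewrite -raddfD /=; congr (res_aug X _); apply: inj.
  by rewrite scalerDr -!gP // ?scalerDl //; apply: idealD.
- move=> r a Ja; rewrite -linearZ /=; congr (res_aug X _); apply: inj.
  by rewrite scalerA (mulrC x) -scalerA -!gP // ?scalerA //; apply: idealMl.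
exists v; split=> [|j Jj]; last by exists (g j); apply: vP.
by rewrite vP //; congr (res_aug X _); apply: inj; apply: gP.
Qed.

Lemma cocycle_divx J v : is_ideal J -> J x -> killed J (d 0%N v) ->
  exists w, aug w = x *: v /\ forall j, J j -> divx (j *: w).
Proof.
move=> idJ Jx Jv.
have JW j : J j -> exists w, aug w = j *: v.
  by move=> Jj; apply/res_exact0; rewrite linearZ /= Jv.
have [w wE] := JW x Jx; exists w; split=> // j /JW[w' w'E]; exists w'.
apply: (@res_aug_inj _ _ X).
by rewrite !linearZ /= w'E wE !scalerA mulrC.
Qed.

Lemma coboundary_divx w v u : aug w = x *: v -> d 0%N v = d 0%N u -> x *: u = 0 -> divx w.
Proof.
move=> wv vu xu; have [w' w'E] : exists w', aug w' = v - u.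
  by apply/res_exact0; rewrite raddfB /= vu subrr.
exists w'; apply: (@res_aug_inj _ _ X).
by rewrite linearZ /= w'E scalerBr xu subr0.
Qed.

Lemma divx_coboundary J w v : aug w = x *: v ->
  (forall j, J j -> exists w', j *: v = aug w') -> divx w ->
  exists u, killed J u /\ d 0%N u = d 0%N v.
Proof.
move=> wv JvW [w' ww']; exists (v - aug w'); split; last first.
  by rewrite raddfB /= res_d_aug subr0.
move=> j /JvW[w'' jv]; rewrite scalerBr jv -linearZ -raddfB /=.
suff -> : w'' - j *: w' = 0 by rewrite linear0.
apply: regW; apply: (@res_aug_inj _ _ X).
rewrite scalerBr raddfB /= !res_augZ -jv scalerA (mulrC x) -scalerA -wv ww'.
by rewrite res_augZ !scalerA (mulrC x) subrr linear0.
Qed.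

End Resolution.
End Canonical.

(** * W/xW as an injective module with simple socle *)

Section TypeOne.
Variables (R : comNzRingType) (m : idealr R).
Hypotheses (noethR : noetherian R) (locR : local_ring m) (dim1 : krull_dim R^o 1).
Variable x : R.
Hypotheses (mx : x \in m) (regx : forall a, x * a = 0 -> a = 0).
Implicit Types (J I : set R) (a r : R).
Variable W : lmodType R.
Hypotheses (regW : forall w : W, x *: w = 0 -> w = 0)
  (injdimW : finite_injdim W) (typeW : bass_number m W 1 1).

Let idm : is_ideal [set a | a \in m]. Proof. exact: mem_idealr. Qed.

(** Ext^1(R/m, W) is the socle of W/xW, so a Bass number 1 in degree 1 makes this socle
    one-dimensional; [s] corresponds to the basis cocycle. *)
Lemma socle_simple : exists s : W, [/\ ~ divx x s,
  forall r, r \in m -> divx x (r *: s)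
  & forall w : W, (forall r, r \in m -> divx x (r *: w)) ->
      exists r, divx x (w - r *: s)].
Proof.
have [K [p [X [e [[psurj pker] ecoc egen eindep]]]]] := typeW.
pose y := e ord0 (p 1).
have hom i (f : {linear K -> res_obj X i}) r : f (p r) = r *: f (p 1).
  by rewrite -!linearZ /=; congr (f (p _)); exact: esym (mulr1 r).
have hom0 i (f : {linear K -> res_obj X i}) : killed [set a | a \in m] (f (p 1)).
  by move=> r mr; rewrite -hom (pker r).2 // linear0.
have [q qP] := choice psurj.
have of_killed i (z : res_obj X i) : killed [set a | a \in m] z ->
    exists f : {linear K -> res_obj X i}, f (p 1) = z.
  move=> mz; have qz a r : p a = p r -> a *: z = r *: z.
    move=> ar; apply/subr0_eq; rewrite -scalerBl; apply: mz.
    by apply/pker; rewrite raddfB /= ar subrr.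
  have [|f fE] := @linear_of_fun _ K (res_obj X i) (fun u => q u *: z).
    move=> a u v; rewrite scalerA -scalerDl; apply: qz; rewrite qP.
    by rewrite raddfD /= !(hom0, qP) -[a * q u]/(a *: (q u : R^o)) linearZ /= !qP.
  by exists f; rewrite fE -[RHS]scale1r; apply: qz; rewrite qP.
have ygen z : res_d X 1 z = 0 -> killed [set a | a \in m] z ->
    exists a u, killed [set a | a \in m] u /\ z = a *: y + res_d X 0 u.
  move=> dz /of_killed[f fz]; have [|a [h [[g hg] fE]]] := egen f.
    by move=> k; rewrite -[k]qP hom fz linearZ /= dz scaler0.
  exists (a ord0), (g (p 1)); split; first exact: hom0.
  by rewrite -fz fE big_ord_recl big_ord0 addr0 hg.
have yindep u : killed [set a | a \in m] u -> res_d X 0 u <> y.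
  move=> /of_killed[g gu] du.
  have [|h hE] := @linear_of_fun _ K (res_obj X 1) (fun k => res_d X 0 (g k)).
    by move=> a k l; rewrite !linearP.
  suff: (1 : R) \in m by rewrite idealr1.
  apply: (eindep (fun=> 1) h) ord0 => [|k]; first by exists g.
  by rewrite hE big_ord_recl big_ord0 addr0 scale1r -[k]qP (hom _ g) (hom _ (e ord0))
    gu linearZ /= du.
have mker : killed [set a | a \in m] y by exact: hom0.
have [v vy] : exists v, res_d X 0 v = y.
  by apply/res_exactS; exact: ecoc.
have /(cocycle_divx idm mx)[s [sv ms]] : killed [set a | a \in m] (res_d X 0 v).
  by rewrite vy.
exists s; split=> //.
  move=> xs; have [|u [mu]] := divx_coboundary regW sv (J := [set a | a \in m]) _ xs.
    by move=> r mr; have [w <-] : exists w, res_aug X w = r *: v;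
      [apply/res_exact0; rewrite linearZ /= vy mker|exists w].
  by rewrite vy; apply: yindep.
have repr w : (forall r, r \in m -> divx x (r *: w)) -> exists t a u,
    [/\ res_aug X w = x *: t, killed [set a | a \in m] u &
        res_d X 0 t = a *: y + res_d X 0 u].
  move=> /(divx_cocycle X regW idm mx)[t [wt mt]].
  have [||a [u [mu tu]]] := ygen (res_d X 0 t).
  - by apply/res_exactS; exists t.
  - by move=> r /mt[w' rt]; rewrite -linearZ /= rt res_d_aug.
  by exists t, a, u.
move=> w /repr[t [a [u [wt mu tu]]]]; exists a.
apply: (@coboundary_divx _ _ _ X _ (t - a *: v) u).
- by rewrite raddfB /= res_augZ wt sv scalerBr !scalerA (mulrC x).
- by rewrite raddfB /= linearZ /= tu vy addrC addKr.
- exact: mu.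
Qed.

(** The map from (I + Ra)/I, a copy of R/m, to W/xW with value [s] extends to R/I, where 1 goes to
    [n]: the obstruction lies in Ext^2(R/(I + Ra), W). *)
Lemma socle_lift s I a : (forall r, r \in m -> divx x (r *: s)) ->
  is_ideal I -> I x -> ~ I a -> (forall r, r \in m -> I (r * a)) ->
  exists n : W, (forall i, I i -> divx x (i *: n)) /\ divx x (a *: n - s).
Proof.
have [X [N X0]] := injdimW.
move=> /(divx_cocycle X regW idm mx)[v [sv mv]] idI Ix nIa Ia.
have mdv : killed [set a | a \in m] (res_d X 0 v).
  by move=> r /mv[w' rv]; rewrite -linearZ /= rv res_d_aug.
have [|y [ay Iy]] :=
  @injective_extend_cyclic R _ I a (res_d X 0 v) (@res_injective _ _ X 1) idI.
  move=> r Ira; apply: mdv; apply/negPn/negP => /(local_unit noethR locR)[b br].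
  by apply: nIa; rewrite -[a]mul1r -br -mulrA; apply: idealMl.
have [|z [Jz dz]] := ext_vanishes2 noethR locR dim1 mx regx X0 (adjoin_ideal a idI)
    (@sub_adjoin _ I a _ Ix) (res_dd y).
  apply: killed_adjoin => [j Ij|]; first by rewrite -linearZ /= Iy // linear0.
  by rewrite -linearZ /= ay res_dd.
have [v' v'E] : exists v', res_d X 0 v' = y - z.
  by apply/res_exactS; rewrite raddfB /= dz subrr.
have [|n [nv' In]] := @cocycle_divx _ _ _ X I v' idI Ix.
  rewrite v'E; apply: killedB => //; apply: killedS Jz; exact: sub_adjoin.
exists n; split=> //.
apply: (@coboundary_divx _ _ _ X _ (a *: v' - v) 0).
- by rewrite raddfB /= res_augZ nv' sv scalerBr !scalerA (mulrC x).
- rewrite raddfB /= linearZ /= v'E scalerBr ay (Jz a) ?subr0 ?subrr ?linear0 //.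
  exact: mem_adjoin.
- by rewrite scaler0.
Qed.

(** If [a] is not in xR, a multiple ba is a nonzero socle element of R/xR, and [socle_lift] gives
    [n] with ban equal to [s] modulo x, hence nonzero. *)
Lemma faithful_mod a : (forall w : W, divx x (a *: w)) -> exists b, a = x * b.
Proof.
move=> aW; apply: contrapT => nxa.
have idxR := principal_ideal x.
have xRx : [set x * r | r in [set: R]] x by exists 1; rewrite ?mulr1.
have [|b [nxba mba]] := socle_mod_regular noethR locR dim1 regx (a := a) idxR xRx.
  by move=> [b _ xb]; apply: nxa; exists b.
have [s [nxs ms _]] := socle_simple.
have [n [_ xn]] := socle_lift ms idxR xRx nxba mba.
apply: nxs; have -> : s = b *: (a *: n) - ((b * a) *: n - s).
  by rewrite scalerA opprB addrC subrK.
by apply: divxB xn; apply: divxZ.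
Qed.

(* f - r kills the elements of W/xW annihilated by I + Ra, hence on those
   annihilated by I it factors through the simple socle, like a does. *)
Lemma endomorphism_mod (f : {linear W -> W}) :
  exists r, forall w, divx x (f w - r *: w).
Proof.
have [s [nxs ms sgen]] := socle_simple.
suff H I : is_ideal I -> I x ->
    exists r, forall w, (forall i, I i -> divx x (i *: w)) -> divx x (f w - r *: w).
  have [||r rP] := H [set x * r | r in [set: R]].
  - exact: principal_ideal.
  - by exists 1; rewrite ?mulr1.
  by exists r => w; apply: rP => _ [b _ <-]; exists (b *: w); rewrite scalerA.
move: I; apply: (regular_ind noethR locR dim1 regx) => [I idI I1|].
  exists 0 => w /(_ 1 I1); rewrite scale1r scale0r subr0 => -[w' ->].
  by exists (f w'); rewrite linearZ.
move=> I a idI Ix nIa Ia [r rP].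
have [n [In an]] := socle_lift ms idI Ix nIa Ia.
have rP' w : (forall i, I i -> divx x (i *: w)) -> divx x (a *: w) -> divx x (f w - r
  *: w).
  move=> Iw aw; apply: rP => _ [i [t [Ii ->]]]; rewrite scalerDl -scalerA.
  by apply: divxD; [apply: Iw|apply: divxZ].
pose f1 w := f w - r *: w.
have f1Z t w : f1 (t *: w) = t *: f1 w.
  by rewrite /f1 linearZ /= scalerBr !scalerA mulrC.
have f1B v w : f1 (v - w) = f1 v - f1 w.
  by rewrite /f1 linearB /= scalerBr !opprB addrACA [RHS]addrACA (addrC (- f w)).
have [|c cP] := sgen (f1 n).
  move=> t mt; rewrite -f1Z; apply: rP' => [i Ii|].
    by rewrite scalerA mulrC -scalerA; apply/divxZ/In.
  by rewrite scalerA mulrC; apply/In/Ia.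
(* Modulo x, [f1] and multiplication by [c * a] agree on [n], both giving c s; and both vanish on w
   - b n, which is killed by I + Ra. *)
exists (r + c * a) => w Iw.
have [|b bP] := sgen (a *: w).
  by move=> t mt; rewrite scalerA; apply/Iw/Ia.
have d1 : divx x (f1 (w - b *: n)).
  apply: rP' => [i Ii|]; first by rewrite scalerBr scalerA mulrC -scalerA;
    apply: divxB; [apply: Iw|apply/divxZ/In].
  have -> : a *: (w - b *: n) = (a *: w - b *: s) - b *: (a *: n - s).
    by rewrite !scalerBr !scalerA mulrC opprB addrA subrK.
  by apply: divxB => //; apply: divxZ.
have -> : f w - (r + c * a) *: w =
    f1 (w - b *: n) + b *: (f1 n - c *: s) - c *: (a *: w - b *: s).
  rewrite f1B f1Z !scalerBr !scalerA addrA subrK opprB addrA (mulrC c b) subrK.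
  by rewrite /f1 scalerDl opprD addrA.
by apply: divxB; [apply: divxD => //|]; apply: divxZ.
Qed.

End TypeOne.

(** * Isomorphisms of modules and of ideals *)

Section ModuleIsomorphisms.
Variable R : comNzRingType.

Lemma linear_of_cancel (U V : lmodType R) (f : {linear U -> V}) (g : V -> U) :
  cancel f g -> cancel g f -> exists h : {linear V -> U}, forall v, h v = g v.
Proof.
move=> fK gK; apply: linear_of_fun => a u v; apply: (can_inj fK).
by rewrite linearP !gK.
Qed.

Lemma mod_iso_sym (U V : lmodType R) : mod_iso U V -> mod_iso V U.
Proof.
case=> f [g fK gK]; have [h hE] := linear_of_cancel fK gK.
by exists h, f => u; rewrite hE ?gK ?fK.
Qed.

Lemma mod_iso_trans (U V W : lmodType R) : mod_iso U V -> mod_iso V W -> mod_iso U W.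
Proof.
case=> f bf [g bg]; have [h hE] := @linear_of_fun _ U W (fun u => g (f u))
  (fun a u v => etrans (congr1 g (linearP f a u v)) (linearP g a _ _)).
exists h; apply: (eq_bij (bij_comp bg bf)) => u; exact: esym (hE u).
Qed.

Lemma finite_injdim_iso (U V : lmodType R) :
  mod_iso U V -> finite_injdim V -> finite_injdim U.
Proof.
case=> f [g fK gK] [X [n X0]].
have [h hE] := @linear_of_fun _ U (res_obj X 0) (fun u => res_aug X (f u))
  (fun a u v => etrans (congr1 _ (linearP f a u v)) (linearP (res_aug X) a _ _)).
have hinj : injective h by move=> u v; rewrite !hE => /(@res_aug_inj _ _ X)/(can_inj fK).
have hex y : res_d X 0 y = 0 <-> exists u, h u = y.
  rewrite res_exact0; split=> [[v <-]|[u <-]]; first by exists (g v); rewrite hE gK.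
  by exists (f u); rewrite hE.
by exists (InjectiveResolution (@res_injective _ _ X) hinj hex (@res_exactS _ _ X)), n.
Qed.

(** The hypotheses amount to cP = eQ, and the isomorphism is multiplication by e / c. *)
Lemma mod_iso_scaling (P Q : ideal R) (c e : R) :
  (forall a, c * a = 0 -> a = 0) -> (forall a, e * a = 0 -> a = 0) ->
  (forall p : R, p \in P -> exists2 q : R, q \in Q & c * p = e * q) ->
  (forall q : R, q \in Q -> exists2 p : R, p \in P & e * q = c * p) ->
  mod_iso (submodule Q) (submodule P).
Proof.
move=> regc rege PQ QP.
have cI a b : c * a = c * b -> a = b.
  by move=> ab; apply/subr0_eq/regc; rewrite mulrBr ab subrr.
have eI a b : e * a = e * b -> a = b.
  by move=> ab; apply/subr0_eq/rege; rewrite mulrBr ab subrr.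
have /choice[f fE] (u : submodule Q) : exists v : submodule P, e * val u = c * val v.
  by have [p Pp up] := QP _ (valP u); exists (Submodule Pp).
have /choice[g gE] (v : submodule P) : exists u : submodule Q, c * val v = e * val u.
  by have [q Qq vq] := PQ _ (valP v); exists (Submodule Qq).
have [|h hE] := @linear_of_fun _ _ _ f.
  move=> a u v; apply/val_inj/cI; rewrite -fE.
  by rewrite /= -[LHS]/(e * (a * val u + val v)) -[RHS]/(c * (a * val (f u) + val (f v)))
    !mulrDr !(mulrCA _ a) !fE.
exists h, g => u; first by apply/val_inj/eI; rewrite hE -gE -fE.
by apply/val_inj/cI; rewrite hE -fE -gE.
Qed.

End ModuleIsomorphisms.

(** * Canonical ideals are faithful and have only scalar endomorphisms *)

Section CanonicalIdeals.
Variables (R : comNzRingType) (m : idealr R).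
Hypotheses (noethR : noetherian R) (locR : local_ring m) (dim1 : krull_dim R^o 1).
Variable x : R.
Hypotheses (mx : x \in m) (regx : forall a, x * a = 0 -> a = 0).
Variables (P : ideal R) (W : lmodType R).
Hypotheses (isoPW : mod_iso (submodule P) W) (injdimW : finite_injdim W)
  (typeW : bass_number m W 1 1).

Lemma canonical_regular (w : W) : x *: w = 0 -> w = 0.
Proof.
have [f [g fK gK]] := isoPW; move=> xw; rewrite -[w]gK.
suff -> : g w = 0 by rewrite linear0.
apply/val_inj/regx; rewrite -[LHS]/(val (x *: g w)).
by rewrite (_ : x *: g w = 0) //; apply: (can_inj fK); rewrite linearZ /= gK xw linear0.
Qed.

(** The annihilator of [P] kills W/xW, so it lies in xR; dividing by the regular [x] stays inside
    it, and Nakayama's lemma applies. *)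
Lemma canonical_faithful (a : R) : (forall p : R, p \in P -> a * p = 0) -> a = 0.
Proof.
pose J : set R := [set a : R | forall p : R, p \in P -> a * p = 0].
have idJ : is_ideal J.
  split=> [p _|b c Jb Jc p Pp|r b Jb p Pp]; first by rewrite mul0r.
    by rewrite mulrDl Jb ?Jc ?addr0.
  by rewrite -mulrA Jb ?mulr0.
apply: (nakayama_principal noethR locR mx (@set0_ideal R) idJ) => b Jb.
have [f [g fK gK]] := isoPW.
have [|c bxc] := faithful_mod noethR locR dim1 mx regx canonical_regular injdimW typeW
  (a := b).
  move=> w; exists 0; rewrite scaler0 -[w]gK -linearZ /=.
  suff -> : b *: g w = 0 by rewrite linear0.
  by apply: val_inj; apply: Jb; apply: valP.
exists c; last by rewrite bxc subrr.
by move=> p Pp; apply: regx; rewrite mulrA -bxc Jb.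
Qed.

(* Elements of P : P, written b / c, are in R. *)
Lemma canonical_colon (c b : R) : c \in P -> (forall a, c * a = 0 -> a = 0) ->
  (forall p : R, p \in P -> exists2 q : R, q \in P & b * p = c * q) -> exists r, b = c
    * r.
Proof.
move=> Pc regc.
have cI a a' : c * a = c * a' -> a = a'.
  by move=> aa'; apply/subr0_eq/regc; rewrite mulrBr aa' subrr.
have xI a a' : x * a = x * a' -> a = a'.
  by move=> aa'; apply/subr0_eq/regx; rewrite mulrBr aa' subrr.
pose J : set R := [set b : R | forall p : R, p \in P -> exists2 q : R, q \in P & b * p
  = c * q].
have idP := mem_ideal P.
have idJ : is_ideal J.
  split=> [p Pp|a a' Ja Ja' p Pp|r a Ja p Pp].
  - by exists 0; [apply: rpred0|rewrite mul0r mulr0].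
  - have [q Pq aq] := Ja p Pp; have [q' Pq' aq'] := Ja' p Pp.
    by exists (q + q'); [apply: rpredD|rewrite mulrDl mulrDr aq aq'].
  - have [q Pq aq] := Ja p Pp; exists (r * q); first exact: (idealMl r idP Pq).
    by rewrite -mulrA aq mulrCA.
(* For [a] in [J], a / c acts on P, and modulo xP as a scalar [r]. Evaluating at [c] gives a = rc +
   x b' with b' again in [J], so J lies in cR + xJ. *)
have JcR : J `<=` [set c * r | r in setT].
  apply: (nakayama_principal noethR locR mx (principal_ideal c) idJ) => a Ja.
  have /choice[q qE] (u : submodule P) : exists v : submodule P, a * val u = c * val v.
    by have [v Pv uv] := Ja _ (valP u); exists (Submodule Pv).
  have [f [g fK gK]] := isoPW; have [g' g'E] := linear_of_cancel fK gK.
  have [|h hE] := @linear_of_fun _ W W (fun w => f (q (g' w))).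
    move=> r u v; rewrite -linearP; congr (f _); apply/val_inj/cI; rewrite -qE linearP.
    by rewrite -[LHS]/(a * (r * val (g' u) + val (g' v)))
      -[RHS]/(c * (r * val (q (g' u)) + val (q (g' v)))) !mulrDr !(mulrCA _ r) !qE.
  have [r rP] := endomorphism_mod noethR locR dim1 mx regx canonical_regular injdimW
    typeW h.
  have qr (p : R) : p \in P -> exists2 p' : R, p' \in P & a * p = c * (r * p + x * p').
    move=> Pp; have [w' w'E] := rP (f (Submodule Pp)).
    exists (val (g w')); first exact: valP.
    rewrite -[p in LHS]/(val (Submodule Pp)) qE; congr (_ * _).
    have : q (Submodule Pp) - r *: Submodule Pp = x *: g w'.
      apply: (can_inj fK); rewrite [RHS]linearZ /= gK -w'E hE g'E fK.
      by rewrite linearB linearZ.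
    move=> /(congr1 val) w''E.
    have -> : x * val (g w') = val (q (Submodule Pp)) - r * p by exact: esym w''E.
    by rewrite addrC subrK.
  have [b' Pb' ab'] := qr c Pc.
  have {ab'}ab' : a = r * c + x * b' by apply: cI; rewrite mulrC.
  exists b'; last by exists r; rewrite // ab' addrK mulrC.
  move=> p Pp; have [p' Pp' ap] := qr p Pp; exists p' => //.
  apply: xI; have -> : x * (b' * p) = a * p - c * (r * p) by rewrite ab'; ring.
  by rewrite ap; ring.
by move=> /JcR[r _ <-]; exists r.
Qed.

End CanonicalIdeals.

(** * From a generic reduction to an isomorphism of Q and P *)

Section Reduction.
Variables (R : comNzRingType) (m : idealr R).
Hypotheses (noethR : noetherian R) (locR : local_ring m).
Variables (L P Q : ideal R) (c : R) (y u : {poly R}) (i0 : nat).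
Hypothesis mulLQ : forall l q : R, l \in L -> q \in Q -> l * q \in P.
Hypothesis genP : forall p : R, p \in P -> exists n (l q : 'I_n -> R),
  [/\ forall i, l i \in L, forall i, q i \in Q & p = \sum_i l i * q i].
Hypotheses (PL : forall p : R, p \in P -> p \in L)
  (PQ : forall p : R, p \in P -> p \in Q).
Hypotheses (Pc : c \in P) (regc : forall a, c * a = 0 -> a = 0).
Hypothesis colonP : forall b : R,
  (forall p : R, p \in P -> exists2 q : R, q \in P & b * p = c * q) ->
  exists r, b = c * r.
Hypotheses (Ly : forall i, y`_i \in L) (ui : u`_i0 \notin m).
Hypothesis uPyQ : forall p : R, p \in P ->
  exists2 h : {poly R}, forall i, h`_i \in Q & u * p%:P = y * h.

Let regu (h : {poly R}) : u * h = 0 -> h = 0.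
Proof. exact: unit_content_reg noethR locR _ _ _ ui. Qed.

Let regcX (h : {poly R}) : c%:P * h = 0 -> h = 0.
Proof.
move=> ch; apply/polyP => i; rewrite coef0; apply: regc.
by rewrite -coefCM ch coef0.
Qed.

Let regy (h : {poly R}) : y * h = 0 -> h = 0.
Proof.
move=> yh; have [h' _ uc] := uPyQ Pc; apply/regu/regcX.
by rewrite mulrCA mulrA uc mulrAC yh mul0r.
Qed.

(* The ideal c (P : Q). *)
Let D : set R := [set e : R | forall q : R, q \in Q -> exists2 p : R, p \in P & e * q =
  c * p].

Let idD : is_ideal D.
Proof.
have idP := mem_ideal P.
split=> [q _|a a' Da Da' q Qq|r a Da q Qq].
- by exists 0; [apply: rpred0|rewrite mul0r mulr0].
- have [p Pp ap] := Da q Qq; have [p' Pp' ap'] := Da' q Qq.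
  by exists (p + p'); [apply: rpredD|rewrite mulrDl mulrDr ap ap'].
- have [p Pp ap] := Da q Qq; exists (r * p); first exact: (idealMl r idP Pp).
  by rewrite -mulrA ap mulrCA.
Qed.

(** Multiplication by h = u e / y sends Q into cQ, since eQ lies in cP and uP in yQ[X]. Hence it
    sends P = LQ into cP, and [colonP] puts the coefficients of h in cR. *)
Let D_mulr (e : R) : D e -> exists v, u * e%:P = y * (c%:P * v).
Proof.
move=> De; have Pe : e \in P.
  have [p Pp ec] := De c (PQ Pc); suff -> : e = p :> R by [].
  by apply: subr0_eq; apply: regc; rewrite mulrBr -ec mulrC subrr.
have [h Qh ueh] := uPyQ Pe.
have hQ k (q : R) : q \in Q -> exists2 q' : R, q' \in Q & h`_k * q = c * q'.
  move=> Qq; have [p Pp eq] := De q Qq; have [h' Qh' uph] := uPyQ Pp.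
  exists h'`_k => //; rewrite -coefMC -coefCM.
  suff -> : h * q%:P = c%:P * h' by [].
  apply: subr0_eq; apply: regy; rewrite mulrBr mulrA -ueh mulrCA -uph.
  by rewrite -mulrA -polyCM eq polyCM mulrCA subrr.
have /choice[v vE] k : exists r, h`_k = c * r.
  apply: colonP => p /genP[n [l [q [Ll Qq ->]]]].
  have /choice[q' q'P] i : exists q' : R, q' \in Q /\ h`_k * q i = c * q'.
    by have [q' Qq' hq'] := hQ k _ (Qq i); exists q'.
  exists (\sum_i l i * q' i).
    by apply: rpred_sum => i _; apply: mulLQ => //; case: (q'P i).
  by rewrite !mulr_sumr; apply: eq_bigr => i _; rewrite mulrCA (q'P i).2 mulrCA.
exists (\poly_(k < size h) v k); rewrite ueh; congr (_ * _); apply/polyP => k.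
rewrite coefCM coef_poly; case: ltnP => [_|hk]; first exact: vE.
by rewrite nth_default // mulr0.
Qed.

(** Since [y] has coefficients in L and cL lies in [D], expanding c y along generators of [D] and
    cancelling gives [uvw]. The unit coefficient of [u] forces one in some [v j]; then [e j]
    generates [D], and cP = e_j Q. *)
Lemma reduction_iso : mod_iso (submodule Q) (submodule P).
Proof.
have [n [e [De genD]]] := ideal_generated noethR idD.
have Dcl (l : R) : l \in L -> D (c * l).
  by move=> Ll q Qq; exists (l * q); [apply: mulLQ|rewrite mulrA].
have /choice[w wE] i : exists r : 'I_n -> R, c * y`_i = \sum_j r j * e j.
  exact/genD/Dcl.
have /choice[v vE] j : exists v, u * (e j)%:P = y * (c%:P * v) by exact: D_mulr.
have uvw : u = \sum_j v j * \poly_(i < size y) w i j.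
  have cy : c%:P * y = \sum_j (e j)%:P * \poly_(i < size y) w i j.
    apply/polyP => i; rewrite coefCM coef_sum.
    have [iy|iy] := ltnP i (size y).
      by rewrite wE; apply: eq_bigr => j _; rewrite coefCM coef_poly iy mulrC.
    rewrite nth_default // mulr0 big1 // => j _.
    by rewrite coefCM coef_poly ltnNge iy mulr0.
  have ucy : u * (c%:P * y) =
      y * (c%:P * \sum_j v j * \poly_(i < size y) w i j).
    by rewrite cy !mulr_sumr; apply: eq_bigr => j _; rewrite mulrA vE !mulrA.
  apply: subr0_eq; apply: regcX; apply: regy; rewrite !mulrBr -ucy.
  by rewrite (_ : y * (c%:P * u) = u * (c%:P * y)) ?subrr //; ring.
have [j [k vjk]] : exists j k, (v j)`_k \notin m.
  apply: contrapT => nv; move/negP: ui; apply.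
  rewrite uvw coef_sum; apply: rpred_sum => j _; rewrite coefM.
  apply: rpred_sum => k _; rewrite mulrC idealMr //.
  by apply/negPn/negP => vjk; apply: nv; exists j, k.
have [b bv] := local_unit noethR locR vjk.
(* Eliminating [u] and [y] between two instances of [D_mulr] gives d v_j = e_j t, whose k-th
   coefficient has a unit next to d. *)
have genD1 (d : R) : D d -> exists r, d = e j * r.
  move=> /D_mulr[t ut]; exists (b * t`_k).
  have dv : d%:P * v j = (e j)%:P * t.
    apply: subr0_eq; apply: regu; rewrite mulrBr !mulrA ut vE.
    by rewrite -!mulrA (mulrC (v j)) subrr.
  have := congr1 (coefp k) dv; rewrite /= coefCM coefCM => dvk.
  by rewrite mulrCA -dvk mulrCA bv mulr1.
have cL (l : R) : l \in L -> exists r, c * l = e j * r by move=> /Dcl/genD1.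
apply: (@mod_iso_scaling _ _ _ c (e j)) => // [a ea|p /genP[k' [l [q [Ll Qq ->]]]]|q Qq].
- have [r ccr] := cL c (PL Pc); apply: regc; apply: regc.
  by rewrite mulrA ccr mulrAC ea mul0r.
- have /choice[r rE] i : exists r, c * l i = e j * r by exact: cL.
  exists (\sum_i r i * q i).
    by apply: rpred_sum => i _; exact: (idealMl (r i) (mem_ideal Q) (Qq i)).
  by rewrite !mulr_sumr; apply: eq_bigr => i _; rewrite !mulrA rE.
- by have [p Pp epq] := De j q Qq; exists p.
Qed.

End Reduction.

(** * The Eakin-Sathaye theorem over an infinite field *)

Section EakinSathaye.
Variables (R : comNzRingType) (K : fieldType) (phi : {rmorphism R -> K}).
Hypothesis infK : forall p : {poly K}, p != 0 -> exists z, p.[z] != 0.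
Variables (s : nat) (a : 'I_s -> R) (Q : nat -> set R).
Hypothesis idQ : forall n, is_ideal (Q n).
Hypothesis mulQ : forall n i g, Q n g -> Q n.+1 (a i * g).
Hypothesis genQ : forall n p, Q n.+1 p ->
  exists h : 'I_s -> R, (forall i, Q n (h i)) /\ p = \sum_i a i * h i.
Implicit Types (lam : R -> K) (t : 'I_s -> K) (T : seq (K * R)).

(* The restriction of lam to Q n is an element of Hom_R(Q n, K). *)
Definition functional n lam := forall r p q, Q n p -> Q n q ->
  lam (r * p + q) = phi r * lam p + lam q.

Definition nonzero_on n lam := exists2 g, Q n g & lam g != 0.

Definition contract t lam g := \sum_i t i * lam (a i * g).

Lemma functional0 n lam : functional n lam -> lam 0 = 0.
Proof.
move=> flam; have := flam 1 0 0 (ideal0 (idQ n)) (ideal0 (idQ n)).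
by rewrite mul1r addr0 rmorph1 mul1r -{1}[lam 0]addr0 => /addrI.
Qed.

Lemma functional_sum n lam k (r p : 'I_k -> R) : functional n lam ->
  (forall i, Q n (p i)) -> lam (\sum_i r i * p i) = \sum_i phi (r i) * lam (p i).
Proof.
move=> flam Qp; suff [] : lam (\sum_i r i * p i) = \sum_i phi (r i) * lam (p i) /\
    Q n (\sum_i r i * p i) by [].
apply: (big_ind2 (fun x y => lam x = y /\ Q n x)) => [|x x' y y' [xx' Qx] [yy' Qy]|i _].
- by split; [apply: functional0 flam|apply: ideal0].
- split; last exact: idealD.
  by rewrite -[x]mul1r flam // rmorph1 mul1r xx' yy'.
- split; last exact: idealMl.
  rewrite -[r i * _]addr0 flam ?(functional0 flam) ?addr0 //; exact: ideal0.
Qed.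

Lemma functional_contract n t lam : functional n.+1 lam -> functional n (contract t lam).
Proof.
move=> flam r p q Qp Qq; rewrite /contract mulr_sumr -big_split /=.
apply: eq_bigr => i _; rewrite mulrDr mulrCA flam; [|exact: mulQ..].
by rewrite mulrDr mulrCA.
Qed.

Lemma nonzero_coordinate n lam : functional n.+1 lam -> nonzero_on n.+1 lam ->
  exists g i, Q n g /\ lam (a i * g) != 0.
Proof.
move=> flam [p Qp lamp]; apply: contrapT => nogi; move/eqP: lamp; apply.
have [h [Qh ->]] := genQ Qp.
under eq_bigr do rewrite -[a _ * _]mul1r.
rewrite (functional_sum _ flam) => [|i]; last exact: mulQ.
apply: big1 => i _; have [->|nz] := eqVneq (lam (a i * h i)) 0; first exact: mulr0.
by case: nogi; exists (h i), i.
Qed.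

(** On the curve t = (1, z, z^2, ...), each condition becomes the nonvanishing at z of a nonzero
    polynomial; some z is not a root of their product. *)
Lemma common_nonzero k (n : 'I_k -> nat) (lam : 'I_k -> R -> K) :
  (forall j, functional (n j).+1 (lam j)) ->
  (forall j, nonzero_on (n j).+1 (lam j)) ->
  exists t, forall j, nonzero_on (n j) (contract t (lam j)).
Proof.
move=> flam nlam.
have /choice[g gP] j : exists g, Q (n j) g /\ exists i, lam j (a i * g) != 0.
  by have [g [i [Qg gi]]] := nonzero_coordinate (flam j) (nlam j); exists g; split=>
    //; exists i.
pose P j : {poly K} :=
  \poly_(i < s) (if insub i is Some i' then lam j (a i' * g j) else 0).
have Pj j : P j != 0.
  have [_ [i nz]] := gP j; apply: contra_neq nz => /(congr1 (coefp i)) /=.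
  by rewrite coef0 coef_poly ltn_ord insubT ?ltn_ord // => ilt;
    rewrite (_ : Sub _ _ = i) //; apply: val_inj.
have [z] : exists z, (\prod_j P j).[z] != 0 by apply: infK; apply/prodf_neq0 => j _.
rewrite horner_prod => /prodf_neq0 Pz.
exists (fun i => z ^+ i) => j; have [Qg _] := gP j; exists (g j) => //.
have := Pz j isT; rewrite horner_poly /contract; congr (_ != 0); apply: eq_bigr => i _.
by rewrite valK mulrC.
Qed.

(* An element of Q d (x) K, acting on the functionals by contraction. *)
Definition act T lam g := \sum_(p <- T) p.1 * lam (p.2 * g).

Definition mulT t T : seq (K * R) :=
  [seq (t i * p.1, a i * p.2) | i <- enum 'I_s, p <- T].

Lemma act_mulT t T lam g : act (mulT t T) lam g = contract t (act T lam) g.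
Proof.
rewrite /act /mulT big_allpairs_dep /contract big_enum /=; apply: eq_bigr => i _.
rewrite mulr_sumr; apply: eq_bigr => p _ /=.
by rewrite -[LHS]mulrA (mulrCA p.2) (mulrA (a i)).
Qed.

Lemma act_mulT_contract t T lam g : act (mulT t T) lam g = act T (contract t lam) g.
Proof.
rewrite /act /mulT big_allpairs_dep big_enum exchange_big /=; apply: eq_bigr => p _.
rewrite /contract mulr_sumr; apply: eq_bigr => i _ /=.
by rewrite mulrA (mulrC p.1) mulrA.
Qed.

Lemma act_sum T k (c : 'I_k -> K) (lam : 'I_k -> R -> K) g :
  act T (fun p => \sum_j c j * lam j p) g = \sum_j c j * act T (lam j) g.
Proof.
rewrite /act; under eq_bigr do rewrite mulr_sumr.
rewrite exchange_big; apply: eq_bigr => j _; rewrite mulr_sumr.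
by apply: eq_bigr => p _; rewrite mulrCA.
Qed.

Lemma functional_act n d T lam :
  (forall p g, p \in T -> Q d g -> Q n (p.2 * g)) ->
  functional n lam -> functional d (act T lam).
Proof.
move=> QT flam r p q Qp Qq; rewrite /act mulr_sumr -big_split /= big_seq [RHS]big_seq.
apply: eq_bigr => t Tt; rewrite mulrDr mulrCA flam; [|exact: QT..].
by rewrite mulrDr mulrCA.
Qed.

(* If every t annihilates some functional, one may choose successively
   Y_0, Y_1, ... and functionals lam_(j+1) annihilated by Y_j such that
   T_j = Y_j ... Y_(k-1) does not annihilate lam_j. *)
Lemma annihilated_chain n :
  (forall t, exists lam, [/\ functional n.+1 lam, nonzero_on n.+1 lam &
     forall g, Q n g -> contract t lam g = 0]) ->
  forall k l, (k + l = n.+1)%N ->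
  exists (T : nat -> seq (K * R)) (lam : nat -> R -> K),
  [/\ forall j, (j <= k)%N -> functional n.+1 (lam j),
      forall j, (j <= k)%N -> forall p d g, p \in T j -> Q d g -> Q (d + (k - j))%N
        (p.2 * g),
      forall j, (j <= k)%N -> nonzero_on (l + j) (act (T j) (lam j))
    & forall i j, (j < i <= k)%N -> forall g, Q (l + j)%N g -> act (T j) (lam i) g = 0].
Proof.
move=> annih; elim=> [|k IHk] l.
  rewrite add0n => ->; have [lam [flam nlam _]] := annih (fun=> 0).
  exists (fun=> [:: (1, 1)]), (fun=> lam); split=> //.
  - by move=> j _ p d g; rewrite inE sub0n addn0 => /eqP->; rewrite mul1r.
  - move=> j; rewrite leqn0 => /eqP->; rewrite addn0; have [g Qg lamg] := nlam.
    by exists g => //; rewrite /act big_seq1 !mul1r.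
  - by move=> i j; rewrite leqn0; case: i => [|i]; rewrite ?ltn0 ?andbF.
move=> kl; have [|T [lam [flam QT nT zT]]] := IHk l.+1; first by rewrite addnS -addSn.
(* This [t] becomes the next factor of every [T j], keeping each of them active on its functional;
   [lam1], annihilated by [t], is the new last functional. *)
have [|j|t tP] := @common_nonzero k.+1 (fun j => l + j)%N (fun j => act (T j) (lam j)).
- move=> j; have jk : (j <= k)%N by rewrite -ltnS.
  apply: functional_act (flam j jk) => p g /(QT j jk) Tp /Tp.
  by rewrite (_ : (_ + _)%N = n.+1) //; lia.
- by have := nT j; rewrite -ltnS => /(_ (ltn_ord j)).
have [lam1 [flam1 nlam1 tlam1]] := annih t.
exists (fun j => if j == k.+1 then [:: (1, 1)] else mulT t (T j)).
exists (fun j => if j == k.+1 then lam1 else lam j).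
split=> [j jk|j jk p d g|j jk|i j /andP[ji ik] g Qg].
- by case: eqP => // jk'; apply: flam; lia.
- case: eqP => [->|jk'].
    by rewrite inE subnn addn0 => /eqP-> /=; rewrite mul1r.
  move=> /allpairsP[[i q] [_ /= Tq ->]] Qg /=.
  have -> : (d + (k.+1 - j) = (d + (k - j)).+1)%N by lia.
  by rewrite -mulrA; apply/mulQ/QT => //; lia.
- case: eqP => [->|jk'].
    have [g Qg lamg] := nlam1; exists g; first by rewrite addnC kl.
    by rewrite /act big_seq1 !mul1r.
  have jk1 : (j < k.+1)%N by lia.
  have [g Qg nz] := tP (Ordinal jk1); exists g => //.
  by rewrite act_mulT.
- have -> : j == k.+1 = false by apply/eqP; lia.
  case: eqP => [ik'|ik'].
    rewrite act_mulT_contract /act big_seq big1 // => p Tp; rewrite tlam1 ?mulr0 //.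
    have jk : (j <= k)%N by lia.
    by have := QT j jk p _ g Tp Qg; rewrite (_ : (_ + _)%N = n) //; lia.
  rewrite act_mulT /contract big1 // => i' _; rewrite zT ?mulr0 //; first lia.
  by rewrite addSn; apply: mulQ.
Qed.

(* In dual form: over K, the linear form with coefficients t times Q n spans
   Q n.+1. *)
Lemma eakin_sathaye n N (b : 'I_N -> R) : (N <= n.+1)%N ->
  (forall l, Q n.+1 (b l)) ->
  (forall p, Q n.+1 p -> exists r : 'I_N -> R, p = \sum_l r l * b l) ->
  exists t, forall lam, functional n.+1 lam ->
    (forall g, Q n g -> contract t lam g = 0) -> forall p, Q n.+1 p -> lam p = 0.
Proof.
move=> Nn Qb genb; apply: contrapT => /forallNP noan.
have [||T [lam [flam QT nT zT]]] := @annihilated_chain n _ n.+1 0%N.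
- move=> t; have /existsNP[lam /not_implyP[flam /not_implyP[tlam /existsNP[p
  /not_implyP[Qp lamp]]]]] := noan t.
  by exists lam; split=> //; exists p => //; apply/eqP.
- exact: addn0.
(* The n + 2 functionals are determined by their values on N <= n + 1 generators, so they are
   dependent. *)
pose A : 'M[K]_(n.+2, N) := \matrix_(j, l) lam j (b l).
have /rowV0Pn[c /sub_kermxP cA c0] : kermx A != 0.
  by rewrite kermx_eq0 /row_free neq_ltn (leq_ltn_trans (rank_leq_col A)).
have cQ p : Q n.+1 p -> \sum_(j < n.+2) c 0 j * lam j p = 0.
  move=> /genb[r ->].
  under eq_bigr => j _ do rewrite (functional_sum r (flam j (ltn_ord j)) Qb) mulr_sumr.
  rewrite exchange_big big1 // => l _; under eq_bigr do rewrite mulrCA.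
  rewrite -mulr_sumr; have /matrixP/(_ 0 l) := cA; rewrite !mxE.
  by under eq_bigr do rewrite mxE; move=> ->; rewrite mulr0.
have /rV0Pn[j0 j0P] := c0.
(* For the least j with nonzero coefficient, [T j] kills all later functionals in the relation and
   leaves c_j times a nonzero one. *)
have [j cj jmin] := @arg_minnP _ j0 (fun j => c 0 j != 0) (fun j : 'I_n.+2 =>
  (j : nat)) j0P.
have jn : (j <= n.+1)%N by rewrite -ltnS.
have [g Qg] := nT j jn; rewrite add0n in Qg; case/eqP.
have : act (T j) (fun p => \sum_(i < n.+2) c 0 i * lam i p) g = 0.
  rewrite /act big_seq big1 // => p Tp; rewrite cQ ?mulr0 //.
  by have := QT j jn p j g Tp Qg; rewrite subnKC.
rewrite act_sum (bigD1 j) //= big1 ?addr0 => [/eqP|i ij].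
  by rewrite mulf_eq0 (negPf cj) => /eqP.
have [->|ci] := eqVneq (c 0 i) 0; first by rewrite mul0r.
rewrite zT ?mulr0 ?add0n //; have := jmin i ci; have := ltn_ord i.
by move: ij; rewrite -val_eqE /=; lia.
Qed.

End EakinSathaye.

(** * Rational functions and denominators *)

Lemma fraction_div (A : idomainType) (z : {fraction A}) :
  exists p q : A, q != 0 /\ z = tofrac p / tofrac q.
Proof.
elim/quotW: z => x; exists \n_x, \d_x; split; first exact: denom_ratioP.
apply: (canRL (mulfK _)); first by rewrite tofrac_eq0 denom_ratioP.
unlock tofrac; rewrite -[LHS]FracField.pi_mul; apply/eqmodP; rewrite /= FracField.equivfE.
by rewrite /FracField.mulf !numden_Ratio ?mulr1 ?oner_eq0 ?denom_ratioP // mulrC.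
Qed.

(** The [size p] distinct powers of X are too many to be all roots of [p]. *)
Lemma fraction_poly_infinite (k : fieldType) (p : {poly {fraction {poly k}}}) :
  p != 0 -> exists z, p.[z] != 0.
Proof.
move=> p0; apply: contrapT => nz.
pose rs : seq {fraction {poly k}} := [seq tofrac 'X^i | i <- iota 0 (size p)].
have : (size rs < size p)%N.
  apply: max_poly_roots => //.
    apply/allP => z _; apply/rootP/eqP/negPn/negP => pz; apply: nz; by exists z.
  rewrite map_inj_uniq ?iota_uniq // => i j /eqP; rewrite tofrac_eq =>
    /eqP/(congr1 (fun q : {poly k} => size q)).
  by rewrite !size_polyXn => -[].
by rewrite size_map size_iota ltnn.
Qed.

Section Denominators.
Variables (A : comNzRingType) (K : fieldType) (psi : {rmorphism A -> K}).
Hypothesis fracA : forall z, exists p q, psi q != 0 /\ z = psi p / psi q.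

Lemma common_denominator (I : finType) (z : I -> K) :
  exists (d : A) (p : I -> A), psi d != 0 /\ forall i, psi (p i) = psi d * z i.
Proof.
have /choice[p /choice[q pqP]] := fun i => fracA (z i).
exists (\prod_i q i), (fun i => p i * \prod_(j | j != i) q j); split.
  by rewrite rmorph_prod; apply/prodf_neq0 => i _; case: (pqP i).
move=> i; have [qi ->] := pqP i; rewrite [in RHS](bigD1 i) //= !rmorphM.
by field.
Qed.

(** A left inverse over K, multiplied by a common denominator d, turns the determinant into
    psi(d)^N. *)
Lemma full_column_rank q N (M : 'M[A]_(q, N)) :
  (forall v : 'cV[K]_N, map_mx psi M *m v = 0 -> v = 0) ->
  exists B : 'M[A]_(N, q), psi (\det (B *m M)) != 0.
Proof.
move=> Minj; have /row_fullP[B BM] : row_full (map_mx psi M).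
  rewrite /row_full -mxrank_tr -/(row_free _) -kermx_eq0; apply/rowV0P => u /sub_kermxP.
  move=> /(congr1 trmx); rewrite trmx_mul trmxK trmx0 => /Minj/(congr1 trmx).
  by rewrite trmxK trmx0.
have [d [B' [d0 B'E]]] := common_denominator (fun ij : 'I_N * 'I_q => B ij.1 ij.2).
exists (\matrix_(i, j) B' (i, j)).
rewrite -det_map_mx map_mxM (_ : map_mx _ (\matrix_(i, j) _) = psi d *: B).
  by rewrite -scalemxAl BM scalemx1 det_scalar expf_neq0.
by apply/matrixP => i j; rewrite !mxE B'E.
Qed.

End Denominators.

(** * The reduction over R[X] *)

Section GenericReduction.
Variables (R : comNzRingType) (m : idealr R).
Hypotheses (noethR : noetherian R) (locR : local_ring m).
Variables (s : nat) (a : 'I_s -> R) (Q : nat -> set R).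
Hypothesis idQ : forall n, is_ideal (Q n).
Hypothesis mulQ : forall n i g, Q n g -> Q n.+1 (a i * g).
Hypothesis genQ : forall n p, Q n.+1 p ->
  exists h : 'I_s -> R, (forall i, Q n (h i)) /\ p = \sum_i a i * h i.

(** [M] writes the products of [y] with generators of Q_n in terms of the [b l]. By Eakin-Sathaye it
    has full column rank over K, and Cramer's rule with u = det(BM) puts u b_l in y Q_n[X]. *)
Lemma generic_reduction n N (b : 'I_N -> R) : (N <= n.+1)%N ->
  (forall l, Q n.+1 (b l)) ->
  (forall p, Q n.+1 p -> exists r : 'I_N -> R, p = \sum_l r l * b l) ->
  (forall r : 'I_N -> R, \sum_l r l * b l = 0 -> forall l, r l \in m) ->
  exists (T : 'I_s -> {poly R}) (u : {poly R}) i0, u`_i0 \notin m /\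
    forall p, Q n.+1 p -> exists2 h : {poly R}, forall i, Q n h`_i &
      u * p%:P = (\sum_i T i * (a i)%:P) * h.
Proof.
move=> Nn Qb genb minb.
have [k [f [f0 fsurj]]] := residue_field noethR locR.
pose K := {fraction {poly k}}.
pose phi : {rmorphism R -> K} := @tofrac _ \o polyC \o f.
pose psi : {rmorphism {poly R} -> K} := @tofrac _ \o map_poly f.
have phi0 r : phi r = 0 <-> r \in m.
  rewrite -f0 /phi /=; split=> [/eqP|->]; last by rewrite !rmorph0.
  by rewrite tofrac_eq0 polyC_eq0 => /eqP.
have psiC r : psi r%:P = phi r by rewrite /psi /= map_polyC.
have psi_surj (p : {poly k}) : exists q, psi q = tofrac p.
  have [g gE] := choice fsurj; exists (\poly_(i < size p) g p`_i).
  rewrite /psi /=; congr (tofrac _); apply/polyP => i; rewrite coef_map coef_poly.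
  by case: ltnP => ip; [exact: gE|rewrite nth_default //; exact: rmorph0].
have frac z : exists p q, psi q != 0 /\ z = psi p / psi q.
  have [p [q [q0 ->]]] : exists p q : {poly k}, q != 0 /\ z = tofrac p / tofrac q.
    exact: fraction_div.
  have [[p' <-] [q' q'E]] := (psi_surj p, psi_surj q).
  by exists p', q'; rewrite q'E tofrac_eq0.
have [t tP] := @eakin_sathaye _ _ phi (@fraction_poly_infinite k) _ _ _ idQ mulQ genQ _
  _ _ Nn Qb genb.
have [d [T [d0 TE]]] := common_denominator frac t.
exists T.
have [q [g [Qg geng]]] := ideal_generated noethR (idQ n).
have /choice[S SE] (ij : 'I_s * 'I_q) : exists r : 'I_N -> R, a ij.1 * g ij.2 = \sum_l
  r l * b l.
  exact/genb/mulQ.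
pose M : 'M[{poly R}]_(q, N) := \matrix_(j, l) \sum_i T i * (S (i, j) l)%:P.
pose bX : 'cV[{poly R}]_N := \col_l (b l)%:P.
pose gX : 'cV[{poly R}]_q := \col_j (g j)%:P.
pose y := \sum_i T i * (a i)%:P.
have Mb : M *m bX = y *: gX.
  apply/colP => j; rewrite !mxE /y mulr_suml.
  under eq_bigr do rewrite !mxE mulr_suml.
  rewrite exchange_big; apply: eq_bigr => i _; rewrite -[RHS]mulrA -polyCM (SE (i, j)).
  by rewrite rmorph_sum mulr_sumr; apply: eq_bigr => l _; rewrite /= polyCM mulrA.
have Minj (v : 'cV[K]_N) : map_mx psi M *m v = 0 -> v = 0.
  move=> Mv.
  have /choice[c cP] p : exists r : 'I_N -> R, Q n.+1 p -> p = \sum_l r l * b l.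
    have [/genb[r pr]|nQp] := pselect (Q n.+1 p); first by exists r.
    by exists (fun=> 0).
  (* A kernel vector [v] is read as the functional taking b_l to v_l, well defined since
     coefficients along minimal generators are unique modulo m. *)
  pose lam p := \sum_l phi (c p l) * v l 0.
  have lamE r : lam (\sum_l r l * b l) = \sum_l phi (r l) * v l 0.
    set p := \sum_l _; apply: eq_bigr => l _; congr (_ * _).
    have Qp : Q n.+1 p by apply: ideal_sum => // l'; apply: idealMl.
    apply/subr0_eq; rewrite -rmorphB; apply/phi0; apply: (minb (fun l => c p l - r l)) l.
    by under eq_bigr do rewrite mulrBl; rewrite sumrB -(cP p Qp) subrr.
  have flam : functional phi Q n.+1 lam.
    move=> r p p' /genb[w ->] /genb[w' ->].
    have -> : r * (\sum_l w l * b l) + \sum_l w' l * b l = \sum_l (r * w l + w' l) * b l.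
      by rewrite mulr_sumr -big_split; apply: eq_bigr => l _; rewrite mulrDl mulrA.
    rewrite !lamE mulr_sumr -big_split; apply: eq_bigr => l _.
    by rewrite rmorphD rmorphM mulrDl mulrA.
  have tlam p : Q n p -> contract a t lam p = 0.
    move=> /geng[r ->].
    rewrite (functional_sum idQ r (functional_contract mulQ t flam) Qg) big1 // => j _.
    suff -> : contract a t lam (g j) = 0 by rewrite mulr0.
    apply: (mulfI d0); rewrite mulr0 /contract mulr_sumr.
    transitivity ((map_mx psi M *m v) j 0); last by rewrite Mv mxE.
    rewrite mxE; under [RHS]eq_bigr do rewrite !mxE rmorph_sum mulr_suml.
    rewrite [RHS]exchange_big; apply: eq_bigr => i _.
    rewrite mulrA -TE (SE (i, j)) lamE mulr_sumr; apply: eq_bigr => l _.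
    by rewrite rmorphM psiC mulrA.
  apply/colP => l; rewrite mxE -[RHS](tP lam flam tlam _ (Qb l)).
  have -> : b l = \sum_l' (l' == l)%:R * b l'.
    by rewrite (bigD1 l) //= eqxx mul1r big1 ?addr0 // => i /negPf->; rewrite mul0r.
  rewrite lamE (bigD1 l) //= eqxx rmorph1 mul1r big1 ?addr0 // => i /negPf->.
  by rewrite rmorph0 mul0r.
have [B detB] := full_column_rank frac Minj.
pose u := \det (B *m M).
have [i0 ui0] : exists i, u`_i \notin m.
  apply: contrapT => num; case/eqP: detB.
  suff : map_poly f u = 0 by rewrite /psi /= -/u => ->; rewrite rmorph0.
  apply/polyP => i; rewrite coef_map coef0; apply/f0/negPn/negP => ui; apply: num.
  by exists i.
exists u, i0; split=> // p /genb[r ->].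
pose w : 'cV[{poly R}]_N := \adj (B *m M) *m (B *m gX).
have ub l : u * (b l)%:P = y * w l 0.
  have -> : u * (b l)%:P = (u *: bX) l 0 by rewrite !mxE.
  by rewrite -mul_scalar_mx -mul_adj_mx -!mulmxA Mb -!scalemxAr mxE.
have Qw l i : Q n (w l 0)`_i.
  rewrite /w mulmxA mxE coef_sum; apply: ideal_sum => // j.
  by have -> : gX j 0 = (g j)%:P by [rewrite mxE]; rewrite coefMC; apply: idealMl.
exists (\sum_l (r l)%:P * w l 0).
  move=> i; rewrite coef_sum; apply: ideal_sum => // l.
  by rewrite coefCM; apply: idealMl.
rewrite rmorph_sum !mulr_sumr; apply: eq_bigr => l _.
by rewrite /= polyCM mulrCA ub mulrCA.
Qed.

End GenericReduction.

(** * Minimal generators and powers of an ideal *)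

Section MinimalGenerators.
Variable R : comNzRingType.

Lemma generated_by_iso (U V : lmodType R) n :
  mod_iso U V -> generated_by U n -> generated_by V n.
Proof.
case=> f [g fK gK] [v vP]; exists (fun i => f (v i)) => x.
have [c cP] := vP (g x); exists c; rewrite -[LHS]gK cP linear_sum.
by apply: eq_bigr => i _; rewrite linearZ.
Qed.

Lemma min_gens_iso (U V : lmodType R) : mod_iso U V -> min_gens U = min_gens V.
Proof.
move=> UV; have VU := mod_iso_sym UV; rewrite /min_gens; congr (xget _ _).
apply/seteqP; split=> n [gn nmin]; split; try exact: generated_by_iso gn.
  by move=> k /(generated_by_iso VU)/nmin.
by move=> k /(generated_by_iso UV)/nmin.
Qed.

Lemma min_gensP (M : lmodType R) : finitely_generated M ->
  generated_by M (min_gens M) /\ forall k, generated_by M k -> (min_gens M <= k)%N.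
Proof.
move=> [n gn]; rewrite /min_gens.
have ex : exists n, `[< generated_by M n >] by exists n; apply/asboolP.
have [k /asboolP gk kmin] := ex_minnP ex.
case: xgetP => [y _ //|]; move=> /(_ k)[]; split=> // l gl; apply: kmin; exact/asboolP.
Qed.

(** A relation with a coefficient outside m, hence a unit, would eliminate a generator. *)
Lemma minimal_generators (m : idealr R) (P : ideal R) :
  noetherian R -> local_ring m ->
  exists b : 'I_(min_gens (submodule P)) -> R, [/\ forall l, b l \in P,
    forall p : R, p \in P -> exists r, p = \sum_l r l * b l
  & forall r, \sum_l r l * b l = 0 -> forall l, r l \in m].
Proof.
move=> noethR locR; have [] := min_gensP (noethR P).
move: (min_gens _) => N [v vP] minN; exists (fun l => val (v l)); split.
- by move=> l; apply: valP.
- move=> p Pp; have [r /(congr1 val)] := vP (Submodule Pp).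
  by rewrite val_lincomb => rP; exists r.
move=> r r0 l; apply/negPn/negP => /(local_unit noethR locR)[c cr].
case: N v vP minN r r0 l cr => [|N] v vP minN r r0 l cr; first by have := ltn_ord l.
suff /minN : generated_by (submodule P) N by rewrite ltnn.
have rv0 : \sum_l r l *: v l = 0 by apply: val_inj; rewrite val_lincomb.
have vl : v l = \sum_i (- (c * r (lift l i))) *: v (lift l i).
  rewrite -[LHS]scale1r -cr -scalerA; move/eqP: rv0.
  rewrite (bigD1_ord l) //= addr_eq0 => /eqP->.
  rewrite scalerN scaler_sumr -sumrN; apply: eq_bigr => i _.
  by rewrite scaleNr scalerA.
exists (fun i => v (lift l i)) => u; have [w ->] := vP u.
exists (fun i => w (lift l i) - w l * (c * r (lift l i))).
rewrite (bigD1_ord l) //= {1}vl scaler_sumr -big_split /=; apply: eq_bigr => i _.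
by rewrite scalerA -scalerDl mulrN addrC.
Qed.

End MinimalGenerators.

Section IdealPowers.
Variables (R : comNzRingType) (L : ideal R).

Lemma mem_idealXS n (l g : R) :
  l \in L -> g \in idealX L n -> l * g \in idealX L n.+1.
Proof.
move=> Ll Qg; apply/asboolP; exists 1%N, (fun=> l), (fun=> g); split=> //.
by rewrite big_ord_recl big_ord0 addr0.
Qed.

Lemma idealXS_sum n (p : R) : p \in idealX L n.+1 ->
  exists k (l g : 'I_k -> R),
    [/\ forall i, l i \in L, forall i, g i \in idealX L n & p = \sum_i l i * g i].
Proof. by move/asboolP. Qed.

Lemma idealXS_sub n (p : R) : p \in idealX L n.+1 -> p \in L.
Proof.
move=> /idealXS_sum[k [l [g [Ll _ ->]]]]; apply: rpred_sum => i _.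
by rewrite mulrC; exact: (rpredZ (g i) (Ll i)).
Qed.

Lemma idealX_sub n (p : R) : p \in idealX L n.+1 -> p \in idealX L n.
Proof.
move=> /idealXS_sum[k [l [g [_ Qg ->]]]]; apply: rpred_sum => i _.
exact: (rpredZ (l i) (Qg i)).
Qed.

Lemma idealX0_iso : mod_iso R^o (submodule (idealX L 0)).
Proof.
have mem0 (a : R^o) : a \in idealX L 0 by [].
have [|f fE] := @linear_of_fun _ R^o (submodule (idealX L 0)) (fun a =>
  Submodule (mem0 a)).
  by move=> a u v; apply: val_inj.
by exists f, val => u; rewrite fE //; apply: val_inj.
Qed.

End IdealPowers.

(** * The bound on tau and on the rootset *)

Section Bound.
Variables (R : comNzRingType) (m : idealr R) (C : ideal R).
Hypotheses (noethR : noetherian R) (locR : local_ring m) (dim1 : krull_dim R^o 1).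

Lemma krull_dim_inj (M : lmodType R) d d' : krull_dim M d -> krull_dim M d' -> d = d'.
Proof.
by move=> [cd dmax] [cd' dmax']; apply/eqP; rewrite eqn_leq dmax' // dmax.
Qed.

Lemma depth_inj (M : lmodType R) d d' : depth m M d -> depth m M d' -> d = d'.
Proof.
move=> [[s [ms rs <-]] smax] [[s' [ms' rs' <-]] smax'].
by apply/eqP; rewrite eqn_leq smax' // smax.
Qed.

Lemma cohen_macaulay_regular : cohen_macaulay m ->
  exists2 x, x \in m & forall a, x * a = 0 -> a = 0.
Proof.
move=> [d [dep kd]]; rewrite (krull_dim_inj kd dim1) in dep.
have [[s [ms [reg _] sz]] _] := dep.
case: s ms reg sz => [|x [|//]] // /andP[mx _] reg _.
exists x => // a xa.
have [|w] := reg 0%N isT a; last by rewrite big_ord0.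
by exists (fun=> 0); rewrite big_ord0; exact: xa.
Qed.

(** The canonical module has depth dim R = 1, so its type is a Bass number in degree 1. *)
Lemma canonical_ideal_type : canonical_ideal m C ->
  exists W : lmodType R, [/\ mod_iso (submodule C) W, finite_injdim W & bass_number m W
    1 1].
Proof.
move=> [W [[[_ [d [dep _ kd]]] [t [dept bass]] inj] iso]]; exists W; split=> //.
by rewrite -{1}(krull_dim_inj kd dim1) (depth_inj dep dept).
Qed.

Section Root.
Variables (x : R) (W : lmodType R).
Hypotheses (mx : x \in m) (regx : forall a, x * a = 0 -> a = 0).
Hypotheses (isoCW : mod_iso (submodule C) W) (injdimW : finite_injdim W)
  (typeW : bass_number m W 1 1).

Lemma tau_lt_min_gens (L : ideal R) n : ~ gorenstein R ->
  is_tau C L n -> (n < min_gens (submodule C))%N.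
Proof.
move=> ngor [[n0 isoPC] nmin]; rewrite ltnNge; apply/negP.
rewrite -(min_gens_iso isoPC) => Nn; case: n n0 isoPC nmin Nn => // n _ isoPC nmin Nn.
have isoPW := mod_iso_trans isoPC isoCW.
set P := idealX L n.+1 in isoPC isoPW Nn.
suff isoQP : mod_iso (submodule (idealX L n)) (submodule P).
  have isoQC := mod_iso_trans isoQP isoPC.
  have [n0|n_gt0] := posnP n; last first.
    by have := nmin n (conj n_gt0 isoQC); rewrite ltnn.
  apply: ngor; apply: finite_injdim_iso injdimW; apply: mod_iso_trans isoCW.
  by apply: mod_iso_trans (idealX0_iso L) _; rewrite -{1}n0.
have faithP := canonical_faithful noethR locR dim1 mx regx isoPW injdimW typeW.
(* This power of [x] is the regular element of [P] used as denominator in the colons. *)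
have [k Pxk] := faithful_ideal_regular noethR locR dim1 mx (mem_ideal P) faithP.
have regc a : x ^+ k * a = 0 -> a = 0 by apply: regX.
have colonP := canonical_colon noethR locR dim1 mx regx isoPW injdimW typeW Pxk regc.
have [s [a [La genL]]] := ideal_generated noethR (mem_ideal L).
have [b [Pb genb minb]] := minimal_generators P noethR locR.
have [|||T [u [i0 [ui0 uP]]]] := generic_reduction noethR locR (a := a)
    (Q := fun n => [set g | g \in idealX L n]) _ _ _ Nn Pb genb minb.
- by move=> k'; apply: mem_ideal.
- by move=> k' i g /= Qg; apply: mem_idealXS Qg; apply: La.
- move=> k' p /= /idealXS_sum[q [l [g [Ll Qg ->]]]].
  have /choice[c cE] := fun i => genL (l i) (Ll i).
  exists (fun j => \sum_i c i j * g i); split=> [j|].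
    by apply: rpred_sum => i _; exact: (rpredZ (c i j) (Qg i)).
  under [RHS]eq_bigr do rewrite mulr_sumr.
  rewrite exchange_big; apply: eq_bigr => i _; rewrite {1}cE mulr_suml.
  by apply: eq_bigr => j _; rewrite mulrA (mulrC (a j)).
apply: (reduction_iso noethR locR (L := L) _ _ _ _ Pxk regc colonP _ ui0 uP).
- by move=> l q; apply: mem_idealXS.
- by move=> p; apply: idealXS_sum.
- by move=> p; apply: idealXS_sub.
- by move=> p; apply: idealX_sub.
move=> i; rewrite coef_sum; apply: (ideal_sum (mem_ideal L)) => j.
by rewrite coefMC; apply: (idealMl _ (mem_ideal L)); apply: La.
Qed.

(** Without generators C would be zero, against its faithfulness. *)
Lemma min_gens_gt0 : (0 < min_gens (submodule C))%N.
Proof.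
rewrite lt0n; apply/eqP => C0; have [] := min_gensP (noethR C); rewrite C0 => -[v vP] _.
case/eqP: (oner_neq0 R).
apply: (canonical_faithful noethR locR dim1 mx regx isoCW injdimW typeW) => p Cp.
rewrite mul1r; have [r] := vP (Submodule Cp); rewrite big_ord0.
by move/(congr1 val).
Qed.

End Root.
End Bound.

Theorem theorem5p8 (R : comNzRingType) (m : idealr R) (C : ideal R) :
  noetherian R ->
  local_ring m ->
  krull_dim (R^o)%R 1 ->
  cohen_macaulay m ->
  canonical_ideal m C ->
  ~ gorenstein R ->
  finite_set (rootset C) /\
  (#|` fset_set (rootset C)| < min_gens (submodule C))%N.
Proof.
move=> noethR locR dim1 cmR canC ngor.
have [x mx regx] := cohen_macaulay_regular dim1 cmR.
have [W [isoCW injdimW typeW]] := canonical_ideal_type dim1 canC.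
(* The values lie among 1, ..., r - 1; as r is positive, these are fewer than r. *)
have bound n : rootset C n -> n \in iota 1 (min_gens (submodule C)).-1.
  move=> [L [_ tau]]; have [[n0 _] _] := tau; rewrite mem_iota n0 add1n prednK.
    exact: (tau_lt_min_gens noethR locR dim1 mx regx isoCW injdimW typeW ngor tau).
  exact: (min_gens_gt0 noethR locR dim1 mx regx isoCW injdimW typeW).
have fin : finite_set (rootset C).
  by apply: sub_finite_set (finite_seq (iota 1 (min_gens (submodule C)).-1)) => n /bound.
split=> //.
rewrite -[ltnRHS]prednK ?ltnS; last first.
  exact: (min_gens_gt0 noethR locR dim1 mx regx isoCW injdimW typeW).
rewrite -[leqRHS](size_iota 1); apply: uniq_leq_size; first exact: fset_uniq.
by move=> n; rewrite in_fset_set // inE => /bound.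
Qed.
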